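(* For any linear Anosov endomorphism $A:\mathbb{T}^2\to\mathbb{T}^2$, there exists a $C^\infty$-smooth $sc$-DA endomorphism $g_0:\mathbb{T}^2\to\mathbb{T}^2$ semi-conjugate to $A$ such that every semi-conjugacy $h:\mathbb{T}^2\to\mathbb{T}^2$ (between $g_0$ and $A$) homotopic to $\mathrm{Id}_{\mathbb{T}^2}$ is non-injective.
   Context: An endomorphism of $\mathbb{T}^2$ means a non-invertible local diffeomorphism that is not expanding ($f$ is expanding if for some $k\in\mathbb{N}$ one has $|Df^k(v)|>1$ for every unit vector $v$). An endomorphism $f$ is partially hyperbolic if there are a continuous splitting $T\mathbb{T}^2=E_1\oplus E_2$ into one-dimensional subbundles ($E_2$ not necessarily $Df$-invariant; $E_1$ may be taken $Df$-invariant) and constants $\alpha>0$, $k\in\mathbb{N}$ such that, with the cones $\mathcal{C}(x)=\{v=v^{E_1}+v^{E_2}\in T_x\mathbb{T}^2: |v^{E_1}|\le\alpha|v^{E_2}|\}$, one has (domination) $Df^k(\mathcal{C}(x))\subset\{v\in T_{f^k(x)}\mathbb{T}^2: |v^{E_1}|<\alpha|v^{E_2}|\}\cup\{0\}$ for all $x$, and at least one of the following holds: (sc) $|Df^k(v)|<1/2$ for all unit $v\in E_1$; (cu) $|Df^k(v)|>2$ for all unit vectors $v$ in the cones $\mathcal{C}$. If both (sc) and (cu) hold, $f$ is an Anosov endomorphism. $f$ is DA (derived from Anosov) if it is partially hyperbolic and its linearization, i.e. the linear toral endomorphism homotopic to $f$, is an Anosov endomorphism; it is $sc$-DA if moreover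 (sc) holds. A linear Anosov endomorphism $A$ is given by an integer matrix with $|\det A|\ge 2$ and eigenvalues $0<|\lambda_s|<1<|\lambda_u|$. $g_0$ is semi-conjugate to $A$ via $h$ if $h:\mathbb{T}^2\to\mathbb{T}^2$ is a continuous surjection homotopic to the identity with $h\circ g_0=A\circ h$. *)

(* Defs.v *)
(* MathComp-Analysis; the real line is an arbitrary realType R. *)
From HB Require Import structures.
From mathcomp Require Import all_boot all_order all_algebra.
From mathcomp Require Import all_classical all_reals all_analysis.

Set Implicit Arguments.
Unset Strict Implicit.
Unset Printing Implicit Defensive.

Import Order.TTheory GRing.Theory Num.Theory.
Import numFieldNormedType.Exports.

Local Open Scope classical_set_scope.
Local Open Scope ring_scope.
Local Open Scope quotient_scope.

Definition euclid (R : realType) (v : 'rV[R]_2) : R :=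
  Num.sqrt (\sum_(i < 2) v 0 i ^+ 2).

Definition Z2 (R : realType) : {pred 'rV[R]_2} :=
  [pred v | v \is a mxOver Num.int].

Lemma Z2_zmod_closed (R : realType) : zmod_closed (@Z2 R).
Proof.
split=> [|u v]; rewrite !inE; first by apply: mxOver_const; exact: rpred0.
move=> /mxOverP uZ /mxOverP vZ; apply/mxOverP => i j.
by rewrite !mxE; exact: rpredB.
Qed.

HB.instance Definition _ (R : realType) :=
  GRing.isZmodClosed.Build 'rV[R]_2 (@Z2 R) (@Z2_zmod_closed R).

(* R^2 / Z^2, as an additive group with the quotient topology. *)
Definition torus (R : realType) : Type :=
  quotient_topology (Quotient.quot (@Z2 R)).

HB.instance Definition _ (R : realType) := Topological.on (torus R).
HB.instance Definition _ (R : realType) := Quotient.on (torus R).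
HB.instance Definition _ (R : realType) :=
  GRing.isZmodule.Build (torus R)
    (@Quotient.addqA _ (@Z2 R)) (@Quotient.addqC _ (@Z2 R))
    (@Quotient.add0q _ (@Z2 R)) (@Quotient.addNq _ (@Z2 R)).

Definition tproj (R : realType) (v : 'rV[R]_2) : torus R := \pi_(torus R) v.

(* The representative of p in the fundamental domain [-1/2, 1/2)^2.  It is
   inverse to tproj there, so v |-> p + tproj v and q |-> tlog (q - p) are
   mutually inverse charts between a neighbourhood of 0 and one of p.  These
   charts differ from one another by translations, and they identify every
   tangent space of the torus with R^2. *)
Definition tlog (R : realType) (p : torus R) : 'rV[R]_2 :=
  \row_i (repr p 0 i - (Num.floor (repr p 0 i + 2^-1))%:~R).

(* f read in the charts centred at p and at f p, meaningful near 0. *)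
Definition tloc (R : realType) (f : torus R -> torus R) (p : torus R)
    (v : 'rV[R]_2) : 'rV[R]_2 :=
  tlog (f (p + tproj v) - f p).

Definition tdiff (R : realType) (f : torus R -> torus R) (p : torus R) :
    'rV[R]_2 -> 'rV[R]_2 :=
  'd (tloc f p) 0.

(* F is of class C^k on U; meant for open U. *)
Fixpoint Ck_on (R : realType) (k : nat) (U : set 'rV[R]_2)
    (F : 'rV[R]_2 -> 'rV[R]_2) : Prop :=
  if k is k'.+1 then
    (forall x, U x -> differentiable F x) /\
    (forall v, Ck_on k' U (fun x => 'D_v F x))
  else forall x, U x -> {for x, continuous F}.

Definition tCk_at (R : realType) (k : nat) (f : torus R -> torus R)
    (p : torus R) : Prop :=
  exists2 U : set 'rV[R]_2, open_nbhs (0 : 'rV[R]_2) U & Ck_on k U (tloc f p).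

Definition tsmooth (R : realType) (f : torus R -> torus R) : Prop :=
  forall k p, tCk_at k f p.

Definition local_diffeo (R : realType) (f : torus R -> torus R) : Prop :=
  forall p, exists (U : set (torus R)) (g : torus R -> torus R),
    [/\ open_nbhs p U, open (f @` U),
        forall q, U q -> tCk_at 1 f q,
        forall q, (f @` U) q -> tCk_at 1 g q &
        forall q, U q -> g (f q) = q].

Definition expanding (R : realType) (f : torus R -> torus R) : Prop :=
  exists k : nat, forall p v, euclid v = 1 -> 1 < euclid (tdiff (iter k f) p v).

Definition endomorphism (R : realType) (f : torus R -> torus R) : Prop :=
  [/\ local_diffeo f, ~ bijective f & ~ expanding f].

(* A family of lines locally spanned by a continuous vector field. *)
Definition line_subbundle (R : realType) (E : torus R -> {vspace 'rV[R]_2}) :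
    Prop :=
  forall p : torus R, exists e : torus R -> 'rV[R]_2, \forall q \near p,
    [/\ {for q, continuous e}, e q != 0 & E q = <[e q]>%VS].

Definition splitting (R : realType) (E1 E2 : torus R -> {vspace 'rV[R]_2}) :
    Prop :=
  [/\ line_subbundle E1, line_subbundle E2 &
      forall p, (E1 p + E2 p = fullv)%VS /\ directv (E1 p + E2 p)].

Definition cone (R : realType) (E1 E2 : torus R -> {vspace 'rV[R]_2})
    (alpha : R) (p : torus R) : set 'rV[R]_2 :=
  [set v | euclid (daddv_pi (E1 p) (E2 p) v) <=
           alpha * euclid (daddv_pi (E2 p) (E1 p) v)].

Definition strict_cone (R : realType) (E1 E2 : torus R -> {vspace 'rV[R]_2})
    (alpha : R) (p : torus R) : set 'rV[R]_2 :=
  [set v | euclid (daddv_pi (E1 p) (E2 p) v) <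
           alpha * euclid (daddv_pi (E2 p) (E1 p) v)].

Definition invariant_subbundle (R : realType) (f : torus R -> torus R)
    (E : torus R -> {vspace 'rV[R]_2}) : Prop :=
  forall p v, v \in E p -> tdiff f p v \in E (f p).

Definition domination (R : realType) (f : torus R -> torus R)
    (E1 E2 : torus R -> {vspace 'rV[R]_2}) (alpha : R) (k : nat) : Prop :=
  forall p, tdiff (iter k f) p @` cone E1 E2 alpha p `<=`
            strict_cone E1 E2 alpha (iter k f p) `|` [set 0].

Definition dominated_splitting (R : realType) (f : torus R -> torus R)
    (E1 E2 : torus R -> {vspace 'rV[R]_2}) (alpha : R) (k : nat) : Prop :=
  [/\ splitting E1 E2, invariant_subbundle f E1, 0 < alpha &
      domination f E1 E2 alpha k].

Definition sc_cond (R : realType) (f : torus R -> torus R)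
    (E1 : torus R -> {vspace 'rV[R]_2}) (k : nat) : Prop :=
  forall p v, v \in E1 p -> euclid v = 1 ->
    euclid (tdiff (iter k f) p v) < 2^-1.

Definition cu_cond (R : realType) (f : torus R -> torus R)
    (E1 E2 : torus R -> {vspace 'rV[R]_2}) (alpha : R) (k : nat) : Prop :=
  forall p v, cone E1 E2 alpha p v -> euclid v = 1 ->
    2 < euclid (tdiff (iter k f) p v).

Definition partially_hyperbolic (R : realType) (f : torus R -> torus R) :
    Prop :=
  endomorphism f /\
  exists E1 E2 alpha k, dominated_splitting f E1 E2 alpha k /\
    (sc_cond f E1 k \/ cu_cond f E1 E2 alpha k).

Definition sc_partially_hyperbolic (R : realType) (f : torus R -> torus R) :
    Prop :=
  endomorphism f /\
  exists E1 E2 alpha k, dominated_splitting f E1 E2 alpha k /\ sc_cond f E1 k.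

Definition anosov (R : realType) (f : torus R -> torus R) : Prop :=
  endomorphism f /\
  exists E1 E2 alpha k, [/\ dominated_splitting f E1 E2 alpha k,
    sc_cond f E1 k & cu_cond f E1 E2 alpha k].

Definition homotopic (R : realType) (f g : torus R -> torus R) : Prop :=
  exists H : R * torus R -> torus R,
    [/\ {within `[0, 1]%classic `*` [set: torus R], continuous H},
        forall p, H (0, p) = f p & forall p, H (1, p) = g p].

(* Points are rows, so x |-> A x reads x |-> x *m A^T. *)
Definition toral_linear (R : realType) (A : 'M[int]_2) (p : torus R) :
    torus R :=
  tproj (repr p *m (map_mx intr A)^T).

Definition linearization (R : realType) (f : torus R -> torus R)
    (B : 'M[int]_2) : Prop :=
  homotopic f (toral_linear B).

Definition DA (R : realType) (f : torus R -> torus R) : Prop :=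
  partially_hyperbolic f /\
  exists B, linearization f B /\ anosov (@toral_linear R B).

Definition sc_DA (R : realType) (f : torus R -> torus R) : Prop :=
  DA f /\ sc_partially_hyperbolic f.

(* Eigenvalues of different moduli of a real 2 x 2 matrix are real, so it is
   enough to look for them in R. *)
Definition linear_anosov (R : realType) (A : 'M[int]_2) : Prop :=
  2 <= `|\det A| /\
  exists ls lu : R,
    [/\ eigenvalue (map_mx intr A) ls, eigenvalue (map_mx intr A) lu,
        0 < `|ls|, `|ls| < 1 & 1 < `|lu|].

Definition semi_conjugacy (R : realType) (h f g : torus R -> torus R) : Prop :=
  [/\ continuous h, range h = [set: torus R] & h \o f = g \o h].

(* Main.v *)
Require Import Defs.
From HB Require Import structures.
From mathcomp Require Import all_boot all_order all_algebra.
From mathcomp Require Import all_classical all_reals all_analysis.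
From mathcomp Require Import perm ring lra.

Set Implicit Arguments.
Unset Strict Implicit.
Unset Printing Implicit Defensive.

Import Order.TTheory GRing.Theory Num.Theory.
Import numFieldNormedType.Exports.

Local Open Scope classical_set_scope.
Local Open Scope ring_scope.
Local Open Scope quotient_scope.

(** Let ls and lu be the stable and unstable eigenvalues of A.  If an eigenline
    were vertical, A would be triangular and ls an integer, which 0 < |ls| < 1
    excludes; so the eigenlines are spanned by vectors es = (1, bs) and
    eu = (1, bu).  The map sought is A precomposed with a shear along the
    unstable direction,
      g0 (x) = A (x + psi_c (x_0) eu),  psi_c (t) = - c / (2 pi) sin (2 pi t),
    with 0 <= c < 1; x_0 is the first coordinate of x.  Most of its properties
    come down to one real variable.

    - The shear is a bijection, since t + psi_c t has derivative at least 1 - c;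
      its inverse is a shear of the same kind.  So g0 is a local diffeomorphism
      (dmap_local_diffeo), and it is as far from being injective as A is
      (dmap_not_bijective).  Letting c go to 0 gives a homotopy to A.

    - The line of eu is invariant, and Dg0 multiplies eu by lu (1 + psi_c'),
      whose modulus is at least L = |lu| (1 - c).  As long as |ls| < L, an
      invariant line spanned by es + s eu and multiplied by ls exists: the slope
      s solves an equation s = b + a (s o g0) with |a| <= |ls| / L < 1, which
      iteration solves (cocycle_solution, stable_slope).  Both lines being
      invariant, domination and contraction follow by comparing powers of ls
      and L (hyperbolic_splitting).  The case c = 0 is A itself, and there L > 1
      also yields expansion of the cones: A is Anosov.

    - A semi-conjugacy of the form h (x) = x + u (x) eu amounts to the equation
      u = psi_c + (u o g0) / lu, again of the type solved by cocycle_solution.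
      It is onto because t + u (x + t eu) takes every real value along each
      unstable line.

    - Choose c with |ls| < L < 1.  The fixed point 0 is then a sink: the points
      of some disc V around it stay near 0 under iteration of g0.  If h is any
      semi-conjugacy, then h (V) stays near the fixed point h (0) under
      iteration of A, so it lies in the local stable segment of h (0).  A
      continuous map from a disc to a segment is not injective
      (no_injection_into_line), and neither is h
      (semi_conjugacy_not_injective). *)

(** * Vectors of the plane *)
Section Plane.
Context {R : realType}.
Implicit Types (x y v w : 'rV[R]_2) (a b t : R).

Definition row2 a b : 'rV[R]_2 := \row_i (if i == 0 then a else b).

Lemma row2E0 a b : row2 a b 0 0 = a. Proof. by rewrite mxE. Qed.
Lemma row2E1 a b : row2 a b 0 1 = b. Proof. by rewrite mxE. Qed.
Definition row2E := (row2E0, row2E1).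

Lemma ord2P (P : 'I_2 -> Prop) : P 0 -> P 1 -> forall i, P i.
Proof.
by move=> P0 P1 [[|[|//]] i]; [move: P0|move: P1];
  congr (P _); apply: val_inj.
Qed.

Lemma eq_row2 x y : x 0 0 = y 0 0 -> x 0 1 = y 0 1 -> x = y.
Proof. by move=> xy0 xy1; apply/rowP; exact: ord2P. Qed.

Lemma norm_row2 v : `|v| = Num.max `|v 0 0| `|v 0 1|.
Proof.
rewrite [LHS]/Num.norm/= mx_normrE; apply/le_anti/andP; split.
  apply: bigmax_le => [|[i j] _] /=; first by rewrite le_max normr_ge0.
  by rewrite [i]ord1; elim/ord2P: j; rewrite le_max lexx ?orbT.
by rewrite ge_max; apply/andP; split;
  rewrite -[leLHS]/((fun ij : 'I_1 * 'I_2 => `|v ij.1 ij.2|) (0, _));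
  apply: le_bigmax.
Qed.

Lemma norm_row2_lt v t : (`|v| < t) = (`|v 0 0| < t) && (`|v 0 1| < t).
Proof. by rewrite norm_row2 gt_max. Qed.

Lemma coord_le_norm v i : `|v 0 i| <= `|v|.
Proof. by rewrite norm_row2 le_max; elim/ord2P: i; rewrite lexx ?orbT. Qed.

Lemma nbhs_row2 x (U : set 'rV[R]_2) :
  nbhs x U <-> exists2 e, 0 < e & forall v, `|v| < e -> U (x + v).
Proof.
split=> [/nbhs_ballP[e /= e0 eU]|[e e0 eU]].
  exists e => // v ve; apply: eU.
  by rewrite -ball_normE /= opprD addrA subrr sub0r normrN.
apply/nbhs_ballP; exists e => //= y; rewrite -ball_normE /= -normrN opprB.
by move=> /eU; rewrite addrC subrK.
Qed.

Lemma continuous_row2 (X : topologicalType) (f g : X -> R) :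
  continuous f -> continuous g -> continuous (fun q => row2 (f q) (g q)).
Proof.
move=> cf cg; have -> : (fun q => row2 (f q) (g q)) =
    (fun q => f q *: row2 1 0 + g q *: row2 0 1).
  by apply/funext => q; apply: eq_row2; rewrite !mxE /=; lra.
by move=> p; apply: cvgD; apply: cvgZr_tmp; [exact: cf|exact: cg].
Qed.

Lemma euclidE v : euclid v = Num.sqrt (v 0 0 ^+ 2 + v 0 1 ^+ 2).
Proof.
by rewrite /euclid big_ord_recl big_ord1; congr (Num.sqrt (_ + v _ _ ^+ _));
  apply: val_inj.
Qed.

Lemma euclidZ t v : euclid (t *: v) = `|t| * euclid v.
Proof.
rewrite !euclidE !mxE !exprMn -mulrDr sqrtrM ?sqr_ge0//.
by rewrite sqrtr_sqr.
Qed.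

Lemma norm_le_euclid v : `|v| <= euclid v.
Proof.
rewrite euclidE norm_row2 ge_max -[`|v 0 0|]sqrtr_sqr -[`|v 0 1|]sqrtr_sqr.
by rewrite !ler_sqrt ?addr_ge0 ?sqr_ge0// lerDl lerDr !sqr_ge0.
Qed.

Lemma euclid_le_norm v : euclid v <= 2 * `|v|.
Proof.
rewrite euclidE -[leRHS]ger0_norm ?mulr_ge0// -sqrtr_sqr ler_sqrt ?sqr_ge0//.
have := coord_le_norm v 0; have := coord_le_norm v 1.
rewrite -(real_normK (num_real (v 0 0))) -(real_normK (num_real (v 0 1))).
have := normr_ge0 (v 0 0); have := normr_ge0 (v 0 1).
move: `|v 0 0| `|v 0 1| `|v| => a b c; nra.
Qed.

Lemma euclid_ge0 v : 0 <= euclid v. Proof. exact: sqrtr_ge0. Qed.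

Lemma euclid_eq0 v : (euclid v == 0) = (v == 0).
Proof.
apply/eqP/eqP => [v0|->]; last first.
  by rewrite -(scale0r 0) euclidZ normr0 mul0r.
by apply/eqP; rewrite -normr_le0 -v0 norm_le_euclid.
Qed.

End Plane.

(** * The torus as a quotient of the plane *)
Section Torus.
Context {R : realType}.
Implicit Types (x y v w : 'rV[R]_2) (p q : torus R).

Lemma tprojK p : tproj (repr p) = p. Proof. exact: reprK. Qed.

Lemma tprojP x y : tproj x = tproj y <-> x - y \in @Z2 R.
Proof.
rewrite (@Quotient.idealrBE _ (@Z2 R)); split => xy; last by move/eqP: xy.
by apply/eqP.
Qed.

Lemma tprojD x y : tproj (x + y) = tproj x + tproj y.
Proof. exact: (@Quotient.pi_add _ (@Z2 R)). Qed.

Lemma tprojN x : tproj (- x) = - tproj x.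
Proof. exact: (@Quotient.pi_opp _ (@Z2 R)). Qed.

Lemma tprojB x y : tproj (x - y) = tproj x - tproj y.
Proof. by rewrite tprojD tprojN. Qed.

Lemma tproj0 : tproj 0 = 0 :> torus R.
Proof. by apply: (addrI (tproj 0)); rewrite -tprojD !addr0. Qed.

Lemma Z2E x : (x \in @Z2 R) = (x 0 0 \is a Num.int) && (x 0 1 \is a Num.int).
Proof.
rewrite inE; apply/mxOverP/andP => [xZ|[x0 x1] i j]; first by split.
by rewrite [i]ord1; elim/ord2P: j.
Qed.

Lemma tproj_continuous : continuous (@tproj R).
Proof. exact: pi_continuous. Qed.

Lemma torus_continuous (X : topologicalType) (f : torus R -> X) :
  continuous (f \o @tproj R) -> continuous f.
Proof. by move=> cf; apply/quotient_continuous. Qed.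

Lemma nbhs_translate x v (U : set 'rV[R]_2) :
  nbhs x U -> nbhs (x + v) [set y | U (y - v)].
Proof.
move=> /nbhs_row2[e e0 eU]; apply/nbhs_row2; exists e => // w we /=.
by rewrite addrAC addrK; apply: eU.
Qed.

(** Saturating an open set by the lattice is a union of translates. Openness of
    the projection is what lets neighbourhoods be transported to the torus,
    also in the presence of a parameter, where a product of quotient maps need
    not be a quotient map. *)
Lemma tproj_open (U : set 'rV[R]_2) : open U -> open (@tproj R @` U).
Proof.
rewrite openE => oU;
  rewrite /open /= /quotient_open openE => y [x Ux] /tprojP xy.
have := nbhs_translate (y - x) (oU _ Ux); rewrite addrC subrK.
apply: filterS => z Uz; exists (z - (y - x)) => //.
by apply/tprojP; rewrite addrAC subrr sub0r opprB.
Qed.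

Lemma nbhs_tproj x (U : set 'rV[R]_2) : nbhs x U -> nbhs (tproj x) (@tproj R @`
  U).
Proof.
move=> Ux; have : nbhs x U by []; rewrite nbhsE => -[V [oV Vx] VU].
rewrite nbhsE.
exists (@tproj R @` V).
  by split; [exact: tproj_open|exists x].
exact: image_subset.
Qed.

Lemma near_tproj x (P : set (torus R)) :
  (\forall y \near x, P (tproj y)) -> \forall q \near tproj x, P q.
Proof.
by move=> /nbhs_tproj; apply: filterS => _ [y Py <-].
Qed.

Lemma tproj_continuous_at (X : topologicalType) (f : torus R -> X) x :
  {for x, continuous (f \o @tproj R)} -> {for tproj x, continuous f}.
Proof. by move=> cf U /cf; exact: near_tproj. Qed.

Lemma torus_continuous2 (Y X : topologicalType) (f : Y * torus R -> X)
    (F : Y * 'rV[R]_2 -> X) :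
  (forall (y : Y) x, f (y, tproj x) = F (y, x)) -> continuous F -> continuous f.
Proof.
move=> fF cF [y p] U; rewrite -(tprojK p) fF => /cF -[[V W] [/= Vy Wx] VWU].
exists (V, @tproj R @` W); first by split => //; apply: nbhs_tproj.
by move=> [z _] /= [Vz [w Ww <-]]; rewrite /= fF; apply: (VWU (z, w)).
Qed.

Lemma tlogP p : tproj (tlog p) = p.
Proof.
rewrite -[RHS]tprojK; apply/tprojP; rewrite Z2E !mxE.
by rewrite [_ - _ - _]addrAC subrr sub0r [_ - _ - _]addrAC subrr sub0r !rpredN
  !intr_int.
Qed.

Lemma int_lt1_eq0 (a : R) : a \is a Num.int -> `|a| < 1 -> a = 0.
Proof.
move=> /intrP[m ->]; rewrite -intr_norm -[1]/(1%:~R) ltr_int.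
by rewrite -[X in _ < X]add0r ltzD1 normr_le0 => /eqP ->.
Qed.

(** The two vectors differ by a lattice vector; as one of them lies in the
    fundamental square and the other in its interior, the coordinates of that
    vector are less than 1. *)
Lemma tlog_small v : `|v| < 2^-1 -> tlog (tproj v) = v.
Proof.
rewrite norm_row2_lt => /andP[v0 v1].
have /tprojP := tlogP (tproj v); rewrite Z2E !mxE => /andP[Z0 Z1].
have tl (i : 'I_2) : - 2^-1 <= tlog (tproj v) 0 i < 2^-1.
  rewrite mxE; have := Num.Theory.floor_itv (repr (tproj v) 0 i + 2^-1).
  set z := Num.floor _; rewrite intrD /=; lra.
move: v0 v1; rewrite !ltr_norml => v0 v1.
by apply: eq_row2; apply/eqP; rewrite -subr_eq0; apply/eqP/int_lt1_eq0;
 rewrite ?mxE //; have := tl 0; have := tl 1; rewrite !mxE ltr_norml; lra.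
Qed.

(** A chart is continuous where its value stays off the boundary of the
    fundamental square: it is there the inverse of a translate of the
    projection. *)
Lemma tlog_continuous (y z : 'rV[R]_2) : `|z - y| < 2^-1 ->
  {for tproj z, continuous (fun p => tlog (p - tproj y))}.
Proof.
move=> zy; apply: tproj_continuous_at => /=.
have H : \forall x \near z, x - y = tlog (tproj x - tproj y).
  apply/nbhs_row2; exists (2^-1 - `|z - y|) => [|v v0];
    first by rewrite subr_gt0.
  rewrite -tprojB tlog_small// addrAC (le_lt_trans (ler_normD _ _))//.
  by rewrite -ltrBrDl.
have cB : {for z, continuous (fun x => x - y)}.
  by apply: continuousB; [exact: cvg_id|exact: cst_continuous].
move=> U; rewrite /= -(nbhs_singleton H) => /cB zU.
have : \forall x \near z, U (x - y) by exact: zU.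
by apply: filterS2 H => x /= ->.
Qed.

Lemma repr_tproj x : repr (tproj x) 0 0 - x 0 0 \is a Num.int.
Proof.
have /tprojP : tproj (repr (tproj x)) = tproj x by rewrite tprojK.
by rewrite Z2E !mxE => /andP[].
Qed.

Lemma periodic_repr_continuous (g : R -> R) : continuous g ->
  (forall t u, t - u \is a Num.int -> g t = g u) ->
  continuous (fun p : torus R => g (repr p 0 0)).
Proof.
move=> cg gZ; apply: torus_continuous.
rewrite (_ : _ \o _ = g \o (fun x : 'rV[R]_2 => x 0 0)).
  by move=> x; apply: continuous_comp; [exact: coord_continuous|exact: cg].
by apply/funext => x; apply: gZ; exact: repr_tproj.
Qed.

End Torus.

(** * Germs and functions of one linear form *)
Section RealContinuity.
Context {R : realType} {X : topologicalType}.
Implicit Types f g : X -> R.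

Lemma continuous_add f g : continuous f -> continuous g ->
  continuous (fun x => f x + g x).
Proof. by move=> cf cg x; apply: cvgD; [exact: cf|exact: cg]. Qed.

Lemma continuous_mul f g : continuous f -> continuous g ->
  continuous (fun x => f x * g x).
Proof. by move=> cf cg x; apply: cvgM; [exact: cf|exact: cg]. Qed.

Lemma continuous_scal (a : R) f : continuous f -> continuous (fun x => a * f x).
Proof. by move=> cf x; apply: cvgMl_tmp; exact: cf. Qed.

End RealContinuity.

Section Germ.
Context {R : realType} {V W : normedModType R}.

Lemma is_diff_near0 (e : V -> W) (x : V) :
  (\forall y \near x, e y = 0) -> is_diff x e 0.
Proof.
move=> e0; have ex : e x = 0 by apply: nbhs_singleton e0.
have eo : e \o shift x = cst (e x) + \0 +o_ 0 id.
  apply/eqaddoP => _/posnumP[d].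
  have -> : e \o shift x - (cst (e x) + \0) = e \o shift x.
    by rewrite ex addr0 subr0.
  move: e0; rewrite (near_shift 0) subr0; apply: filterS => h /= ->.
  by rewrite normr0 mulr_ge0.
have c0 : continuous (\0 : V -> W) by move=> y; exact: cvg_cst.
have e' : 'd e x = \0 :> (V -> W) by apply: diff_unique.
by apply: DiffDef => //; apply/diff_locallyP; rewrite e'.
Qed.

(** Charts agree with lifts only near a point, so differentials have to be
    transferred along equality of germs: the difference is a germ of 0, and
    differentials add. *)
Lemma is_diff_near (f g df : V -> W) (x : V) :
  (\forall y \near x, f y = g y) -> is_diff x f df -> is_diff x g df.
Proof.
move=> fg fdf; have e0 : is_diff x (g - f) 0.
  by apply: is_diff_near0; apply: filterS fg => y /= fgy;
    rewrite -[LHS]/(g y - f y) fgy subrr.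
have -> : g = f + (g - f) by rewrite addrC subrK.
by rewrite -[df]addr0; exact: (is_diffD fdf e0).
Qed.

End Germ.

Section Ridge.
Context {R : realType}.
Implicit Types (M : 'M[R]_2) (l a d x v : 'rV[R]_2) (w : R -> R).

Definition lform l v : R := l 0 0 * v 0 0 + l 0 1 * v 0 1.

Lemma lform_is_linear l : linear (lform l : _ -> R^o).
Proof. by move=> t u v; rewrite /lform !mxE /GRing.scale /=; ring. Qed.

HB.instance Definition _ l :=
  GRing.isLinear.Build R 'rV[R]_2 R^o _ (lform l) (lform_is_linear l).

Lemma coord_continuous_at i x : {for x, continuous (fun v : 'rV[R]_2 => v 0 i)}.
Proof. exact: coord_continuous. Qed.

Lemma lform_continuous l : continuous (lform l).
Proof.
have cl i x : {for x, continuous (fun v : 'rV[R]_2 => l 0 i * v 0 i)}.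
  by apply: continuousM; [exact: cst_continuous|exact: coord_continuous_at].
by move=> x; exact: (continuousD (cl 0 x) (cl 1 x)).
Qed.

Lemma mulmxr_continuous M : continuous (mulmxr M : 'rV[R]_2 -> 'rV[R]_2).
Proof.
have cl i x : {for x, continuous (fun v : 'rV[R]_2 => v 0 i *: row i M)}.
  by apply: continuousZr_tmp; exact: coord_continuous_at.
rewrite (_ : (mulmxr M : 'rV[R]_2 -> 'rV[R]_2) =
    (fun v => v 0 0 *: row 0 M + v 0 1 *: row 1 M)).
  by move=> x; exact: (continuousD (cl 0 x) (cl 1 x)).
apply/funext => v /=; rewrite mulmx_sum_row big_ord_recl big_ord1.
by have -> : lift ord0 ord0 = 1 :> 'I_2 by apply: val_inj.
Qed.

(** The lift of the perturbed map and those of its local inverses all have this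
    shape: an affine map plus a function of one linear form in a fixed
    direction. It is preserved by translations and, when w is a sine, by
    directional derivatives, so that regularity is a question about w. *)
Definition ridge M l w a d v : 'rV[R]_2 := v *m M + w (lform l v) *: a + d.

Lemma is_diff_ridge M l w (w' : R) a d x :
  is_derive (lform l x) 1 w w' ->
  is_diff x (ridge M l w a d) (fun v => v *m M + (w' * lform l v) *: a).
Proof.
move=> dw.
have dM : is_diff x (mulmxr M : 'rV[R]_2 -> 'rV[R]_2) (mulmxr M).
  apply: DiffDef; first exact/linear_differentiable/mulmxr_continuous.
  exact/diff_lin/mulmxr_continuous.
have dl : is_diff x (lform l : _ -> R) (lform l).
  apply: DiffDef; first exact/linear_differentiable/lform_continuous.
  exact/diff_lin/lform_continuous.
have ddw : is_diff (lform l x) (w : R -> R) (fun h => h *: w').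
  have dw1 : derivable w (lform l x) 1 by [].
  apply: DiffDef; first exact/derivable1_diffP.
  by rewrite deriv1E // derive1E derive_val.
have da : is_diff (w (lform l x)) (fun t : R => t *: a) (fun t => t *: a).
  exact: is_diff_scalel.
have -> : ridge M l w a d = (mulmxr M : 'rV[R]_2 -> 'rV[R]_2) +
    ((fun t => t *: a) \o (w \o lform l)) + cst d.
  by apply/funext => v.
have dwl : is_diff x (w \o lform l) ((fun h => h *: w') \o lform l).
  exact: is_diff_comp.
have dwla : is_diff x ((fun t => t *: a) \o (w \o lform l))
    ((fun t => t *: a) \o ((fun h => h *: w') \o lform l)).
  exact: is_diff_comp.
apply: is_diff_eq (is_diffD (is_diffD dM dwla) (is_diff_cst d x)) _.
by apply/funext => v; rewrite addr0 fctE /= /GRing.scale /= mulrC.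
Qed.

End Ridge.

(** * Reading smoothness on lifts *)
Section Smoothness.
Context {R : realType}.
Implicit Types (M : 'M[R]_2) (l a d x v : 'rV[R]_2) (w : R -> R)
  (U : set 'rV[R]_2) (F G : 'rV[R]_2 -> 'rV[R]_2) (f : torus R -> torus R).

Lemma differentiable_near F G x :
  (\forall y \near x, F y = G y) -> differentiable F x -> differentiable G x.
Proof.
move=> FG dF; have FdF : is_diff x F ('d F x) by apply: DiffDef.
by have [] := is_diff_near FG FdF.
Qed.

Lemma open_near_eq U F G x : open U -> (forall y, U y -> F y = G y) -> U x ->
  \forall y \near x, F y = G y.
Proof. by rewrite openE => oU FG /oU; apply: filterS => y /FG. Qed.

Lemma Ck_on_ext k U F G : open U -> (forall x, U x -> F x = G x) ->
  Ck_on k U F -> Ck_on k U G.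
Proof.
move=> oU; elim: k F G => [|k IH] F G FG /=.
  move=> cF x Ux V; rewrite -FG// => /(cF _ Ux) FV.
  have : \forall y \near x, V (F y) by exact: FV.
  by apply: filterS2 (open_near_eq oU FG Ux) => y /= ->.
move=> [dF cF]; split=> [x Ux|v].
  exact: differentiable_near (open_near_eq oU FG Ux) (dF _ Ux).
apply: IH (cF v) => x Ux.
by apply: near_eq_derive; exact: open_near_eq oU FG Ux.
Qed.

Lemma Ck_on_sub k U V F : U `<=` V -> Ck_on k V F -> Ck_on k U F.
Proof.
move=> UV; elim: k F => [|k IH] F /=; first by move=> cF x /UV; exact: cF.
by move=> [dF cF]; split => [x /UV|v]; [exact: dF|exact: IH].
Qed.

Lemma deriv_ridge M l w (w' : R) a d x v :
  is_derive (lform l x) 1 w w' ->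
  'D_v (ridge M l w a d) x = v *m M + (w' * lform l v) *: a.
Proof.
move=> /is_diff_ridge dr; have dr' := dr M a d.
by rewrite deriveE// diff_val.
Qed.

Lemma Ck1_ridge U M l w (w' : R -> R) a d :
  (forall t : R, is_derive t 1 w (w' t)) -> continuous w' ->
  Ck_on 1 U (ridge M l w a d).
Proof.
move=> dw cw'; split=> [x _|v x _].
  by have [] := is_diff_ridge M a d (dw (lform l x)).
have -> : (fun x => 'D_v (ridge M l w a d) x) =
    (fun x => v *m M + (w' (lform l x) * lform l v) *: a).
  by apply/funext => y; apply: deriv_ridge.
apply: continuousD; first exact: cst_continuous.
apply: continuousZr_tmp; apply: continuousM; last exact: cst_continuous.
apply: (@continuous_comp _ _ _ (lform l) w'); first exact: lform_continuous.
exact: cw'.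
Qed.

Lemma is_derive_sin_phase (s k t : R) :
  is_derive t 1 (fun u => sin (k * u + s)) (k * sin (k * t + (s + pi / 2))).
Proof.
rewrite addrA sinDpihalf; apply: is_derive_eq.
by rewrite /GRing.scale /= !(mulr1,addr0,mulr0,add0r) mulrC.
Qed.

(** Differentiating a sine shifts its phase by a quarter of a period, and thus
    gives a ridge again: the statement reproduces itself. *)
Lemma Ck_ridge_sin n U M l k s a d :
  Ck_on n U (ridge M l (fun t => sin (k * t + s)) a d).
Proof.
elim: n M s a d => [|n IH] M s a d /=.
  move=> x _; apply: differentiable_continuous.
  by have [] := is_diff_ridge M a d (is_derive_sin_phase s k (lform l x)).
split=> [x _|v].
  by have [] := is_diff_ridge M a d (is_derive_sin_phase s k (lform l x)).
have -> : (fun x => 'D_v (ridge M l (fun t => sin (k * t + s)) a d) x) =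
    ridge 0 l (fun t => sin (k * t + (s + pi / 2))) ((k * lform l v) *: a)
      (v *m M).
  apply/funext => x; rewrite (deriv_ridge _ _ _ _ (is_derive_sin_phase s k _)).
  by rewrite /ridge mulmx0 add0r addrC scalerA; congr (_ *: _ + _); ring.
exact: IH.
Qed.

Lemma ridge_shift M l w a d x v :
  ridge M l w a d (x + v) =
  ridge M l (fun t => w (t + lform l x)) a (x *m M + d) v.
Proof.
rewrite /ridge linearD /= mulmxDl (addrC (lform l x)).
by rewrite -!addrA (addrCA (x *m M)); congr (_ + _); rewrite addrCA.
Qed.

(** The difference of the values of a continuous lift is small, hence lies in
    the fundamental square on which tlog inverts the projection. *)
Lemma tloc_lift f x F : (\forall z \near x, f (tproj z) = tproj (F z)) ->
  {for x, continuous F} ->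
  \forall v \near (0 : 'rV[R]_2), tloc f (tproj x) v = F (x + v) - F x.
Proof.
move=> fF cF.
have cF' : \forall z \near x, `|F z - F x| < 2^-1.
  have : nbhs (F x) [set y | `|y - F x| < 2^-1].
    by apply/nbhs_row2; exists 2^-1 => // v /=; rewrite addrAC subrr add0r.
  exact: cF.
have [e1 e10 fF1] := (nbhs_row2 _ _).1 fF.
have [e2 e20 cF2] := (nbhs_row2 _ _).1 cF'.
apply/nbhs_row2; exists (Num.min e1 e2); rewrite ?lt_min ?e10// => v.
rewrite lt_min => /andP[v1 v2]; rewrite add0r /tloc -tprojD fF1//.
by rewrite (nbhs_singleton fF) -tprojB tlog_small// cF2.
Qed.

Lemma tdiff_lift f x F : (\forall z \near x, f (tproj z) = tproj (F z)) ->
  differentiable F x -> tdiff f (tproj x) = 'd F x :> ('rV[R]_2 -> 'rV[R]_2).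
Proof.
move=> fF dF; have near0 := tloc_lift fF (differentiable_continuous dF).
have dG : is_diff 0 (fun v => F (x + v) - F x) ('d F x).
  have dxv : is_diff 0 (fun v => x + v) (id : 'rV[R]_2 -> 'rV[R]_2).
    apply: is_diff_eq (is_diffD (is_diff_cst x 0) (is_diff_id 0)) _.
    by rewrite add0r.
  have dFx : is_diff (x + 0) F ('d F x) by rewrite addr0; apply: DiffDef.
  apply: is_diff_eq (is_diffB (is_diff_comp dxv dFx) (is_diff_cst (F x) 0)) _.
  by rewrite subr0.
have near0' : \forall v \near (0 : 'rV[R]_2), F (x + v) - F x = tloc f (tproj
  x) v.
  by apply: filterS near0 => v ->.
by have [_ E] := is_diff_near near0' dG; exact: E.
Qed.

Lemma tdiff_linear f (p : torus R) (a b : R) (v w : 'rV[R]_2) :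
  tdiff f p (a *: v + b *: w) = a *: tdiff f p v + b *: tdiff f p w.
Proof. by rewrite /tdiff linearD !linearZ. Qed.

(** The function G is the lift recentred at x; it is taken as a parameter so
    that it can be supplied in whichever form makes its regularity visible. *)
Lemma tCk_at_lift k f x F G : (\forall z \near x, f (tproj z) = tproj (F z)) ->
  {for x, continuous F} ->
  (forall v, F (x + v) - F x = G v) -> Ck_on k setT G -> tCk_at k f (tproj x).
Proof.
move=> fF cF FG CG; have := tloc_lift fF cF.
move=> H; have : nbhs (0 : 'rV[R]_2) [set v | tloc f (tproj x) v = F (x + v) -
  F x].
  exact: H.
rewrite nbhsE => -[V oV0 VH]; have [oV _] := oV0; exists V => //.
apply: (@Ck_on_ext _ _ G) => // [v /VH /= ->//|].
exact: Ck_on_sub CG.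
Qed.

Lemma tCk1_ridge (g : torus R -> torus R) x M l w (w' : R -> R) a d :
  (\forall z \near x, g (tproj z) = tproj (ridge M l w a d z)) ->
  (forall t : R, is_derive t 1 w (w' t)) -> continuous w' ->
  tCk_at 1 g (tproj x).
Proof.
move=> gr dw cw'.
have cr : {for x, continuous (ridge M l w a d)}.
  apply: differentiable_continuous.
  by have [] := is_diff_ridge M a d (dw (lform l x)).
apply: (@tCk_at_lift _ _ _ _ (ridge M l (fun t => w (t + lform l x)) a
    (x *m M + d - ridge M l w a d x)) gr cr) => [v|].
  by rewrite [in X in X - _]ridge_shift /ridge !addrA.
apply: (@Ck1_ridge _ _ _ _ (fun t => w' (t + lform l x))) => [t|].
  have dt : is_derive t 1 (fun t => t + lform l x) (1 + 0).
    exact: is_deriveD.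
  have := @is_derive1_comp R w (fun t => t + lform l x) t _ _ (dw _) dt.
  by rewrite addr0 mulr1.
move=> t; apply: (@continuous_comp _ _ _ (fun t => t + lform l x) w').
  by apply: continuous_add => [?|?]; [exact: cvg_id|exact: cvg_cst].
exact: cw'.
Qed.

End Smoothness.

(** * Cohomological equations over a contraction *)
Section GeometricDecay.
Context {R : realType}.

Lemma geometric_small (r B e : R) : 0 <= r < 1 -> 0 < e ->
  \forall n \near \oo, r ^+ n * B < e.
Proof.
move=> /andP[r0 r1] e0.
have : (fun n => r ^+ n * B) @ \oo --> (0 : R).
  by rewrite -[X in _ --> X](mul0r B); apply: cvgMr_tmp; apply: cvg_expr;
    rewrite ger0_norm.
by move=> /cvgrPdist_lt/(_ _ e0); apply: filterS => n;
  rewrite sub0r normrN => /ltr_normlW.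
Qed.

Lemma geometric_le0 (r B y : R) : 0 <= r < 1 ->
  (forall n, y <= r ^+ n * B) -> y <= 0.
Proof.
move=> r01 yB; rewrite leNgt; apply/negP => y0.
have [n _ /(_ n (leqnn n))] := geometric_small B r01 y0.
by rewrite /= ltNge yB.
Qed.

(** The iterates of the operator s |-> b + a (s o f) from 0 form a Cauchy
    sequence for the uniform norm at geometric speed r, and a uniform limit of
    continuous functions is continuous. Both the slope of the stable line and
    the semi-conjugacy to A are obtained from this equation. *)
Lemma cocycle_solution (X : topologicalType) (f : X -> X) (a b : X -> R)
    (r C : R) : continuous f -> continuous a -> continuous b ->
    0 <= r < 1 -> (forall p, `|a p| <= r) -> (forall p, `|b p| <= C) ->
  exists s : X -> R, [/\ continuous s, forall p, s p = b p + a p * s (f p) &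
    forall p, `|s p| <= C / (1 - r)].
Proof.
move=> cf ca cb r01 ar bC; have [r0 r1] := andP r01.
pose S := fix S n p : R := if n is m.+1 then b p + a p * S m (f p) else 0.
pose B := C / (1 - r).
(* B is the bound invariant under iteration: C + r B = B. *)
have BE : C + r * B = B by rewrite /B; field; lra.
have SB n p : `|S n p| <= B.
  elim: n p => [|n IH] p /=.
    by rewrite normr0 /B divr_ge0 ?subr_ge0 ?(ltW r1)// (le_trans _ (bC p)).
  rewrite -BE (le_trans (ler_normD _ _))// lerD// normrM.
  exact: ler_pM.
have SS n m p : `|S (n + m)%N p - S n p| <= r ^+ n * B.
  elim: n p => [|n IH] p /=; first by rewrite subr0 expr0 mul1r.
  rewrite opprD addrACA subrr add0r -mulrBr normrM exprS -mulrA.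
  exact: ler_pM.
have Scvg p : cvg (S ^~ p @ \oo).
  apply/cauchy_cvgP/cauchy_exP => e e0.
  have [n _ /(_ n (leqnn n)) /= rne] := geometric_small B r01 e0.
  exists (S n p); apply: filterS (nbhs_infty_ge n) => m nm /=.
  rewrite -ball_normE /= distrC; apply: le_lt_trans rne.
  by rewrite -(subnKC nm).
pose s p := lim (S ^~ p @ \oo).
have sS n p : `|s p - S n p| <= r ^+ n * B.
  apply/ler_addgt0Pr => e e0.
  have /cvgrPdist_lt/(_ _ e0) [N _ sN] := Scvg p.
  have /= := sN (maxn n N) (leq_maxr _ _).
  have := SS n (maxn n N - n)%N p; rewrite subnKC ?leq_maxl// => S1 S2.
  by rewrite (le_trans (ler_distD (S (maxn n N) p) _ _))// addrC lerD// ltW.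
exists s; split.
- move=> p; apply/cvgrPdist_lt => e e0.
  have e30 : 0 < e / 3 by rewrite divr_gt0.
  have [n _ /(_ n (leqnn n)) /= rne] := geometric_small B r01 e30.
  have cS : continuous (S n).
    elim: n {rne} => [|n IH] q /=; first exact: cvg_cst.
    apply: (@cvgD _ _ X); first exact: cb.
    apply: (@cvgM _ X); first exact: ca.
    by apply: (@continuous_comp _ _ _ f (S n)); [exact: cf|exact: IH].
  have /cvgrPdist_lt/(_ _ e30) := cS p; apply: filterS => q /= Spq.
  have := sS n p; have := sS n q; rewrite (distrC (s q)) => Sq Sp.
  have := ler_distD (S n p) (s p) (s q);
    have := ler_distD (S n q) (S n p) (s q).
  move: (`|s p - s q|) (`|s p - S n p|) (`|S n p - s q|) (`|S n p - S n q|)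
    (`|S n q - s q|) Spq Sp Sq => t1 t2 t3 t4 t5; lra.
- move=> p; apply/eqP; rewrite -subr_eq0 -normr_le0.
  apply: (@geometric_le0 r (2 * B)) => // n.
  have := sS n.+1 p; have := sS n (f p) => /= s1 s2.
  have s3 : `|a p * (S n (f p) - s (f p))| <= r ^+ n * B.
    rewrite normrM distrC -[leRHS]mul1r; apply: ler_pM => //.
    by rewrite (le_trans (ar p))// ltW.
  have rr : r ^+ n.+1 * B <= r ^+ n * B.
    rewrite ler_wpM2r// ?(le_trans _ (SB 0%N p))// exprS ler_piMl ?exprn_ge0//.
    exact: ltW.
  rewrite (_ : s p - _ = (s p - (b p + a p * S n (f p))) +
    a p * (S n (f p) - s (f p))); last by ring.
  rewrite (le_trans (ler_normD _ _))//.
  move: (`|s p - _|) s2 (`|a p * _|) s3 => u su v sv; lra.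
- by move=> p; have := sS 0%N p; rewrite subr0 expr0 mul1r.
Qed.

End GeometricDecay.

(** * The periodic perturbation *)
Section Dent.
Context {R : realType}.
Implicit Types (c t u : R).

(** The sine is normalised so that the slope at 0 is - c, the least slope of
    dent c; dent' c is the derivative. *)
Definition dent c t : R := - (c / (2 * pi)) * sin (2 * pi * t).
Definition dent' c t : R := - c * cos (2 * pi * t).

Lemma trig_int_shift (s : R -> R) t u : periodic s (pi *+ 2) ->
  t - u \is a Num.int -> s (2 * pi * t) = s (2 * pi * u).
Proof.
move=> sP tuZ.
have sn (n : nat) (v : R) : s (2 * pi * (v + n%:R)) = s (2 * pi * v).
  rewrite -[RHS](periodicn sP n) mulrDr; congr (s (_ + _)).
  by rewrite -[pi *+ 2]mulr_natl -[RHS]mulr_natr.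
move: tuZ => /intrP[[n|n] tu].
  by rewrite -(subrK u t) tu addrC; exact: sn.
have -> : u = t + n.+1%:R.
  by move: tu; rewrite NegzE intrN -pmulrn; lra.
by rewrite sn.
Qed.

Lemma dent_shift c t u : t - u \is a Num.int -> dent c t = dent c u.
Proof. by move=> /(trig_int_shift (@sinD2pi R)) E; rewrite /dent E. Qed.

Lemma dent'_shift c t u : t - u \is a Num.int -> dent' c t = dent' c u.
Proof. by move=> /(trig_int_shift (@cosD2pi R)) E; rewrite /dent' E. Qed.

Lemma pi2_gt0 : 0 < 2 * pi :> R.
Proof. by rewrite mulr_gt0// pi_gt0. Qed.

Lemma dentE c t : dent c t = - (c / (2 * pi)) * sin (2 * pi * t + 0).
Proof. by rewrite addr0. Qed.

Lemma is_derive_dent c t : is_derive t 1 (dent c) (dent' c t).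
Proof.
have ds := is_derive_sin_phase 0 (2 * pi) t.
rewrite (_ : dent c = (- (c / (2 * pi))) *: (fun u => sin (2 * pi * u + 0))).
  apply: is_derive_eq.
  rewrite add0r sinDpihalf /dent' /GRing.scale /= mulrA; congr (_ * _).
  by move: pi (pi_gt0 R) => q q0; field; exact: lt0r_neq0.
by apply/funext => u; rewrite dentE.
Qed.

Lemma dent_continuous c : continuous (dent c).
Proof.
move=> t; apply: differentiable_continuous; apply/derivable1_diffP.
by have [] := is_derive_dent c t.
Qed.

Lemma dent'_continuous c : continuous (dent' c).
Proof.
move=> t; apply: cvgMl_tmp;
  apply: (@continuous_comp _ _ _ (fun t => 2 * pi * t) cos).
  by apply: cvgMl_tmp; exact: cvg_id.
exact: continuous_cos.
Qed.

Lemma dent'_le c t : 0 <= c -> `|dent' c t| <= c.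
Proof.
by move=> c0; rewrite normrM normrN (ger0_norm c0) ler_piMr// cos_max.
Qed.

Lemma dent_le c t : 0 <= c -> `|dent c t| <= c / (2 * pi).
Proof.
move=> c0; have c'0 : 0 <= c / (2 * pi) by rewrite divr_ge0// ltW// pi2_gt0.
by rewrite normrM normrN (ger0_norm c'0) ler_piMr// sin_max.
Qed.

Lemma dent0 c : dent c 0 = 0. Proof. by rewrite /dent mulr0 sin0 mulr0. Qed.
Lemma dent'0 c : dent' c 0 = - c. Proof. by rewrite /dent' mulr0 cos0 mulr1.
  Qed.
Lemma dent_flat t : dent 0 t = 0. Proof. by rewrite /dent !mul0r oppr0 mul0r.
  Qed.

End Dent.

(** * Eigenlines of the matrix *)
Section Eigen.
Context {R : realType}.
Implicit Types (A : 'M[int]_2) (ls lu bs bu c : R).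

Definition torusmx A : 'M[R]_2 := (map_mx intr A)^T.

Lemma mul_torusmx A (x : 'rV[R]_2) i :
  (x *m torusmx A) 0 i = x 0 0 * (A i 0)%:~R + x 0 1 * (A i 1)%:~R.
Proof.
rewrite !mxE big_ord_recl big_ord1 !mxE.
by have -> : lift ord0 ord0 = 1 :> 'I_2 by apply: val_inj.
Qed.

Lemma torusmx_Z2 A (x : 'rV[R]_2) : x \in @Z2 R -> x *m torusmx A \in @Z2 R.
Proof.
rewrite !Z2E !mul_torusmx => /andP[x0 x1].
by apply/andP; split; apply: rpredD; apply: rpredM => //; exact: intr_int.
Qed.

(** Eigenvectors of A acting on columns are those of the transpose acting on
    rows. *)
Record eigenframe A ls lu bs bu : Prop := Eigenframe {
  stable_eig : row2 1 bs *m torusmx A = ls *: row2 1 bs;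
  unstable_eig : row2 1 bu *m torusmx A = lu *: row2 1 bu;
  slope_neq : bs != bu;
  ls_gt0 : 0 < `|ls|; ls_lt1 : `|ls| < 1; lu_gt1 : 1 < `|lu| }.

(** Were the upper right entry of A zero, the eigenvalues would be the diagonal
    entries, hence integers, against 0 < |ls| < 1. As it is not, the
    eigenvector for l can be normalised to (1, (l - a) / b), where (a, b) is
    the first row of A. *)
Lemma linear_anosov_eigenframe A : @linear_anosov R A ->
  exists ls lu bs bu, eigenframe A ls lu bs bu.
Proof.
move=> [_ [ls [lu [/eigenvalueP[v vA v0] /eigenvalueP[w wA w0] ls0 ls1 lu1]]]].
set a : R := (A 0 0)%:~R; set b : R := (A 0 1)%:~R.
set c : R := (A 1 0)%:~R; set d : R := (A 1 1)%:~R.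
have charpoly (l : R) (u : 'rV[R]_2) : u *m map_mx intr A = l *: u -> u != 0 ->
    (l - a) * (l - d) = b * c.
  move=> uA u0.
  have E i : u 0 0 * (A 0 i)%:~R + u 0 1 * (A 1 i)%:~R = l * u 0 i.
    have <- : (u *m map_mx intr A) 0 i = l * u 0 i by rewrite uA mxE.
    rewrite !mxE big_ord_recl big_ord1 !mxE.
    by have -> : lift ord0 ord0 = 1 :> 'I_2 by apply: val_inj.
  have := E 0; have := E 1; rewrite -/a -/b -/c -/d => E1 E0.
  have [u00|u00] := eqVneq (u 0 0) 0.
    have u01 : u 0 1 != 0.
      by apply: contra_neq u0 => u01; apply: eq_row2; rewrite mxE.
    apply: (mulfI u01); apply/eqP; rewrite -subr_eq0.
    rewrite (_ : _ - _ = (l - a) * (l * u 0 1 - (u 0 0 * b + u 0 1 * d)) -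
      b * (u 0 0 * a + u 0 1 * c - l * u 0 0)); last by rewrite u00; ring.
    by rewrite E1 E0 !subrr !mulr0 subr0.
  apply: (mulfI u00); apply/eqP; rewrite -subr_eq0.
  rewrite (_ : _ - _ = (l - d) * (l * u 0 0 - (u 0 0 * a + u 0 1 * c)) +
    c * (l * u 0 1 - (u 0 0 * b + u 0 1 * d))); last by ring.
  by rewrite E1 E0 !subrr !mulr0 addr0.
have cs := charpoly _ _ vA v0; have cu := charpoly _ _ wA w0.
have b0 : b != 0.
  apply/negP => /eqP b0; have lsZ : ls \is a Num.int.
    move/eqP: cs; rewrite b0 mul0r mulf_eq0 !subr_eq0.
    by move=> /orP[] /eqP ->; exact: intr_int.
  by move: ls0; rewrite (int_lt1_eq0 lsZ ls1) normr0 ltxx.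
have eig (l : R) : (l - a) * (l - d) = b * c ->
    row2 1 ((l - a) / b) *m torusmx A = l *: row2 1 ((l - a) / b).
  move=> cl; apply: eq_row2; rewrite mul_torusmx !mxE /= -/a -/b -/c -/d.
    by field.
  apply: (mulfI b0); rewrite mul1r mulrDr -cl; field; exact: b0.
exists ls, lu, ((ls - a) / b), ((lu - a) / b); split => //.
- exact: eig.
- exact: eig.
- apply/negP => /eqP/(divIf b0)/addIr lsu.
  by move: ls1 lu1; rewrite lsu => /lt_trans h /h; rewrite ltxx.
Qed.

End Eigen.

(** * The perturbed endomorphism *)
Section DentedMap.
Context {R : realType} (A : 'M[int]_2) (lu bu : R).
Implicit Types (c t : R) (x y v : 'rV[R]_2) (p q : torus R).

Local Notation eu := (row2 1 bu : 'rV[R]_2).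

(** This is A applied to the sheared point x + dent c (x 0 0) *: eu, in the
    expanded form that exhibits it as a ridge (see dlift_shear). *)
Definition dlift c x : 'rV[R]_2 :=
  x *m torusmx A + (lu * dent c (x 0 0)) *: eu.

Definition dmap c p : torus R := tproj (dlift c (repr p)).

Lemma dlift_Z2 c x y : x - y \in @Z2 R -> dlift c x - dlift c y \in @Z2 R.
Proof.
move=> xy; have /andP[] : ((x - y) 0 0 \is a Num.int) && ((x - y) 0 1 \is a
  Num.int).
  by rewrite -Z2E.
rewrite !mxE => xy0 _; rewrite /dlift (dent_shift c xy0).
by rewrite opprD addrACA subrr addr0 -mulmxBl torusmx_Z2.
Qed.

Lemma dmap_tproj c x : dmap c (tproj x) = tproj (dlift c x).
Proof. by apply/tprojP/dlift_Z2/tprojP; rewrite tprojK. Qed.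

Lemma iter_dmap_tproj c k x :
  iter k (dmap c) (tproj x) = tproj (iter k (dlift c) x).
Proof. by elim: k => //= k ->; exact: dmap_tproj. Qed.

Lemma dmap_flat : dmap 0 = @toral_linear R A.
Proof.
by apply/funext => p; rewrite /dmap /dlift dent_flat mulr0 scale0r addr0.
Qed.

Lemma toral_linear_tproj x : toral_linear A (tproj x) = tproj (x *m torusmx A).
Proof.
by rewrite -dmap_flat dmap_tproj /dlift dent_flat mulr0 scale0r addr0.
Qed.

Lemma lform10 x : lform (row2 1 0) x = x 0 0.
Proof. by rewrite /lform !row2E mul1r mul0r addr0. Qed.

Lemma dlift_ridge c : dlift c =
  ridge (torusmx A) (row2 1 0) (dent c) (lu *: eu) 0.
Proof.
by apply/funext => x; rewrite /dlift /ridge lform10 addr0 scalerA mulrC.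
Qed.

Lemma dlift_ridge_sin c : dlift c =
  ridge (torusmx A) (row2 1 0) (fun t => sin (2 * pi * t + 0))
    ((lu * - (c / (2 * pi))) *: eu) 0.
Proof.
apply/funext => x; rewrite /dlift /ridge lform10 addr0 scalerA dentE.
by congr (_ + _ *: _); ring.
Qed.

Lemma is_diff_dlift c x : is_diff x (dlift c)
  (fun v => v *m torusmx A + (lu * dent' c (x 0 0) * v 0 0) *: eu).
Proof.
have := is_diff_ridge (torusmx A) (lu *: eu) 0 (is_derive_dent c (lform (row2 1
  0) x)).
rewrite -dlift_ridge => h; apply: is_diff_eq h _.
by apply/funext => v; rewrite !lform10 scalerA; congr (_ + _ *: _); ring.
Qed.

Lemma differentiable_dlift c x : differentiable (dlift c) x.
Proof. by have [] := is_diff_dlift c x. Qed.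

Lemma diff_dlift c x v :
  'd (dlift c) x v = v *m torusmx A + (lu * dent' c (x 0 0) * v 0 0) *: eu.
Proof. by have [_ E] := is_diff_dlift c x; rewrite E. Qed.

Lemma dlift_continuous c : continuous (dlift c).
Proof.
by move=> x; apply: differentiable_continuous; exact: differentiable_dlift.
Qed.

Lemma dmap_continuous c : continuous (dmap c).
Proof.
apply: torus_continuous.
have -> : dmap c \o @tproj R = @tproj R \o dlift c.
  by apply/funext => x; exact: dmap_tproj.
by move=> x; apply: continuous_comp;
  [exact: dlift_continuous|exact: tproj_continuous].
Qed.

Lemma dmap_lifts c x : \forall z \near x, dmap c (tproj z) = tproj (dlift c z).
Proof. by near=> z; exact: dmap_tproj. Unshelve. all: by end_near. Qed.

Lemma tCk_dmap c k p : tCk_at k (dmap c) p.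
Proof.
rewrite -(tprojK p); set x := repr p.
apply: (@tCk_at_lift _ _ _ _ _ (ridge (torusmx A) (row2 1 0)
    (fun t => sin (2 * pi * t + 2 * pi * lform (row2 1 0) x))
    ((lu * - (c / (2 * pi))) *: eu) (x *m torusmx A + 0 - dlift c x))
    (dmap_lifts c x) (@dlift_continuous c x)) => [v|].
  by rewrite [in X in X - _]dlift_ridge_sin ridge_shift /ridge /= mulrDr !addr0
    !addrA.
exact: Ck_ridge_sin.
Qed.

End DentedMap.

(** * Invariant directions *)
Section Bundles.
Context {R : realType} (A : 'M[int]_2) (ls lu bs bu c : R).
Context (fr : eigenframe A ls lu bs bu).
Context (c0 : 0 <= c) (c1 : c < 1) (dom : `|ls| < `|lu| * (1 - c)).
Implicit Types (x y v : 'rV[R]_2) (p q : torus R).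

Local Notation es := (row2 1 bs : 'rV[R]_2).
Local Notation eu := (row2 1 bu : 'rV[R]_2).
Local Notation F := (dlift A lu bu c).
Local Notation f := (dmap A lu bu c).

Lemma differentiable_iter_dlift k x : differentiable (iter k F) x.
Proof.
elim: k x => [|k IH] x; first by have [] := is_diff_id x.
apply: (@differentiable_comp _ _ _ _ (iter k F) F); first exact: IH.
exact: differentiable_dlift.
Qed.

Lemma tdiff_iter_dmap k x :
  tdiff (iter k f) (tproj x) = 'd (iter k F) x :> (_ -> _).
Proof.
apply: tdiff_lift; last exact: differentiable_iter_dlift.
by near=> z; exact: iter_dmap_tproj.
Unshelve. all: by end_near. Qed.

Lemma tdiff_iter0 p v : tdiff (iter 0 f) p v = v.
Proof.
rewrite -(tprojK p) (tdiff_iter_dmap 0).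
by have [_ E] := is_diff_id (repr p); rewrite [LHS](congr1 (@^~ v) E).
Qed.

(** The chain rule, read on the lifts. *)
Lemma tdiff_iterS k p v :
  tdiff (iter k.+1 f) p v = tdiff f (iter k f p) (tdiff (iter k f) p v).
Proof.
rewrite -(tprojK p); set x := repr p.
rewrite iter_dmap_tproj (tdiff_iter_dmap k.+1) (tdiff_iter_dmap k).
rewrite (tdiff_iter_dmap 1).
have := @diff_comp _ _ _ _ (iter k F) F x (differentiable_iter_dlift k x)
  (@differentiable_dlift _ A lu bu c _).
by move=> /(congr1 (@^~ v)).
Qed.

Lemma tdiff_dmap p v : tdiff f p v =
  v *m torusmx A + (lu * dent' c (repr p 0 0) * v 0 0) *: eu.
Proof.
by rewrite -{1}(tprojK p) (tdiff_iter_dmap 1) (diff_dlift A).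
Qed.

Definition rate p : R := lu * (1 + dent' c (repr p 0 0)).

Lemma rate_continuous : continuous rate.
Proof.
have := periodic_repr_continuous (@dent'_continuous R c) (@dent'_shift R c).
move=> cd; apply: continuous_scal; apply: continuous_add => // p.
exact: cst_continuous.
Qed.

(** The slope of the dent is at least - c, with equality at the fixed
    point 0. *)
Lemma rate_ge p : `|lu| * (1 - c) <= `|rate p|.
Proof.
rewrite normrM ler_wpM2l//; have := dent'_le (repr p 0 0) c0.
rewrite ler_norml => /andP[d0 d1].
have d2 : 1 - c <= 1 + dent' c (repr p 0 0) by rewrite lerD2l.
by rewrite ger0_norm// (le_trans _ d2)// subr_ge0 ltW.
Qed.

Lemma rate_neq0 p : rate p != 0.
Proof.
rewrite -normr_gt0 (lt_le_trans _ (rate_ge p))// (le_lt_trans _ dom)//.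
Qed.

Lemma tdiff_unstable p : tdiff f p eu = rate p *: eu.
Proof.
rewrite tdiff_dmap (unstable_eig fr) row2E mulr1 -scalerDl; congr (_ *: _).
by rewrite /rate mulrDr mulr1.
Qed.

Lemma tdiff_iter_unstable k p : exists2 mu : R,
  (`|lu| * (1 - c)) ^+ k <= `|mu| & tdiff (iter k f) p eu = mu *: eu.
Proof.
elim: k => [|k [mu muk E]].
  exists 1; first by rewrite expr0 normr1.
  by rewrite tdiff_iter0 scale1r.
exists (rate (iter k f p) * mu).
  by rewrite exprS normrM ler_pM ?rate_ge// ?exprn_ge0// mulr_ge0// subr_ge0
    ltW.
rewrite tdiff_iterS E -[mu *: _]addr0 -(scale0r eu) tdiff_linear scale0r addr0.
by rewrite tdiff_unstable scalerA mulrC.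
Qed.

(** The derivative maps es + s eu to ls es + (lu dent' + s rate) eu, and asking
    for this to be ls times the same vector at the image point is an equation
    for s, contracting because the unstable rate exceeds |ls| everywhere. The
    stable line is thus determined by the future orbit, which is unique even
    though the map is not injective. *)
Lemma stable_slope : exists s : torus R -> R, [/\ continuous s,
  exists C, forall p, `|s p| <= C &
  forall p, tdiff f p (es + s p *: eu) = ls *: (es + s (f p) *: eu)].
Proof.
have r0 : 0 < `|lu| * (1 - c) by exact: le_lt_trans dom.
have lu0 : 0 < `|lu| by apply: lt_trans (lu_gt1 fr).
have Vrate p : `|(rate p)^-1| <= (`|lu| * (1 - c))^-1.
  by rewrite normfV lef_pV2 ?posrE ?rate_ge// normr_gt0 rate_neq0.
have cV : continuous (fun p => (rate p)^-1).
  by move=> p; apply: (continuousV (rate_neq0 p)); exact: rate_continuous.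
have [] := @cocycle_solution R (torus R) f (fun p => ls * (rate p)^-1)
  (fun p => - (lu * dent' c (repr p 0 0)) * (rate p)^-1)
  (`|ls| / (`|lu| * (1 - c))) (`|lu| * c * (`|lu| * (1 - c))^-1).
- exact: dmap_continuous.
- exact: continuous_scal.
- apply: continuous_mul => //.
  rewrite (_ : (fun p => - _) = (fun p => - lu * dent' c (repr p 0 0))).
    apply: continuous_scal.
    exact: (periodic_repr_continuous (@dent'_continuous R c) (@dent'_shift R
      c)).
  by apply/funext => p; rewrite mulNr.
- by rewrite divr_ge0// ?(ltW r0)//= ltr_pdivrMr// mul1r.
- by move=> p; rewrite normrM ler_wpM2l.
- move=> p; rewrite normrM normrN normrM ler_pM// ?mulr_ge0//.
  by rewrite ler_wpM2l// dent'_le.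
move=> s [cs sE sC]; exists s; split=> //; first by eexists; exact: sC.
move=> p; rewrite -[es in LHS]scale1r tdiff_linear tdiff_unstable.
rewrite tdiff_dmap (stable_eig fr) row2E mulr1 scale1r scalerA scalerDr scalerA.
rewrite -addrA -scalerDl; congr (_ + _ *: _).
rewrite [in LHS]sE; have := rate_neq0 p => rp0; field; exact: rp0.
Qed.

Lemma tdiff_iter_stable s :
  (forall p, tdiff f p (es + s p *: eu) = ls *: (es + s (f p) *: eu)) ->
  forall k p, tdiff (iter k f) p (es + s p *: eu) =
    ls ^+ k *: (es + s (iter k f p) *: eu).
Proof.
move=> sE k p; elim: k => [|k IH].
  by rewrite tdiff_iter0 expr0 scale1r.
rewrite tdiff_iterS IH -[ls ^+ k *: _]addr0 -(scale0r eu) tdiff_linear.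
by rewrite scale0r addr0 sE scalerA -exprSr.
Qed.

End Bundles.

(** * Domination, contraction and expansion *)
Section PlaneFrame.
Context {R : realType}.
Implicit Types (e v : 'rV[R]_2) (a b : R).

Definition frame e1 e2 := e1 0 0 * e2 0 1 - e1 0 1 * e2 0 0 != 0.

Lemma frame_decomp e1 e2 v : frame e1 e2 ->
  exists a b, v = a *: e1 + b *: e2.
Proof.
rewrite /frame; set D := _ - _ => D0.
exists ((v 0 0 * e2 0 1 - v 0 1 * e2 0 0) / D),
  ((e1 0 0 * v 0 1 - e1 0 1 * v 0 0) / D).
by apply: eq_row2; rewrite !mxE; apply: (mulfI D0); rewrite /D; field.
Qed.

Lemma frame_free e1 e2 a b : frame e1 e2 -> a *: e1 = b *: e2 -> a = 0.
Proof.
rewrite /frame => D0 ab.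
have E i : a * e1 0 i = b * e2 0 i by have := congr1 (fun u : 'rV_2 => u 0 i)
  ab; rewrite !mxE.
apply: (mulIf D0); rewrite mul0r mulrBr !mulrA !E.
by ring.
Qed.

Lemma frame_cap e1 e2 : frame e1 e2 -> (<[e1]> :&: <[e2]> = 0)%VS.
Proof.
move=> D0; apply/eqP; rewrite -subv0; apply/subvP => v.
rewrite memv_cap => /andP[/vlineP[a va] /vlineP[b vb]].
have a0 : a = 0 by apply: (@frame_free e1 e2 a b D0); rewrite -va -vb.
by rewrite va a0 scale0r mem0v.
Qed.

Lemma frame_splitting e1 e2 : frame e1 e2 ->
  (<[e1]> + <[e2]> = fullv)%VS /\ directv (<[e1]> + <[e2]>).
Proof.
move=> D0; split; last by apply/directv_addP/frame_cap.
apply/eqP; rewrite eqEsubv subvf /=; apply/subvP => v _.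
have [a [b ->]] := frame_decomp v D0.
by apply: memv_add; apply/vlineP; [exists a|exists b].
Qed.

Lemma frame_sym e1 e2 : frame e1 e2 -> frame e2 e1.
Proof.
by rewrite /frame -oppr_eq0 opprB; congr (_ != 0); ring.
Qed.

Lemma frame_pil e1 e2 a b : frame e1 e2 ->
  daddv_pi <[e1]> <[e2]> (a *: e1 + b *: e2) = a *: e1.
Proof.
move=> D0; have D0' := frame_sym D0.
have pi0 : daddv_pi <[e1]> <[e2]> e2 = 0.
  have := @daddv_pi_add _ _ <[e1]>%VS <[e2]>%VS e2 (frame_cap D0).
  rewrite (daddv_pi_id (frame_cap D0')) ?memv_line// => h.
  apply: (addIr e2); rewrite add0r h// -[X in X \in _]add0r.
  by apply: memv_add; rewrite ?mem0v ?memv_line.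
by rewrite linearD !linearZ /= pi0 scaler0 addr0 (daddv_pi_id (frame_cap D0))
  ?memv_line.
Qed.

Lemma frame_pir e1 e2 a b : frame e1 e2 ->
  daddv_pi <[e2]> <[e1]> (a *: e1 + b *: e2) = b *: e2.
Proof. by move=> /frame_sym D0; rewrite addrC frame_pil. Qed.

Lemma frame_neq0 e1 e2 : frame e1 e2 -> e1 != 0.
Proof.
by rewrite /frame; apply: contra_neq => ->; rewrite !mxE !mul0r subrr.
Qed.

End PlaneFrame.

Section Hyperbolicity.
Context {R : realType} (A : 'M[int]_2) (ls lu bs bu c : R).
Context (fr : eigenframe A ls lu bs bu).
Context (c0 : 0 <= c) (c1 : c < 1) (dom : `|ls| < `|lu| * (1 - c)).
Implicit Types (x y v : 'rV[R]_2) (p q : torus R).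

Local Notation es := (row2 1 bs : 'rV[R]_2).
Local Notation eu := (row2 1 bu : 'rV[R]_2).
Local Notation f := (dmap A lu bu c).
Local Notation L := (`|lu| * (1 - c)).

Section Slope.
Context (s : torus R -> R) (C : R).
Context (cs : continuous s) (sC : forall p, `|s p| <= C).
Context (sE : forall p,
  tdiff f p (es + s p *: eu) = ls *: (es + s (f p) *: eu)).

Definition stable_dir p : 'rV[R]_2 := es + s p *: eu.

Local Notation E1 := (fun p => <[stable_dir p]>%VS).
Local Notation E2 := (fun _ : torus R => <[eu]>%VS).

Lemma stable_frame p : frame (stable_dir p) eu.
Proof.
rewrite /frame !mxE /= (_ : _ - _ = bu - bs); last by ring.
by rewrite subr_eq0 eq_sym (slope_neq fr).
Qed.

Lemma stable_dir_continuous : continuous stable_dir.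
Proof.
have -> : stable_dir = fun p => row2 (1 + s p) (bs + s p * bu).
  by apply/funext => p; apply: eq_row2; rewrite !mxE /=; ring.
apply: continuous_row2.
  by apply: continuous_add => // q; exact: cst_continuous.
apply: continuous_add => [q|]; first exact: cst_continuous.
by apply: continuous_mul => // q; exact: cst_continuous.
Qed.

Lemma stable_dir_le p : euclid (stable_dir p) <= 2 * (`|es| + C * `|eu|).
Proof.
rewrite (le_trans (euclid_le_norm _))// ler_wpM2l//.
by rewrite (le_trans (ler_normD _ _))// lerD2l normrZ ler_wpM2r.
Qed.

(** A lower bound for the length of es + s eu whatever s is: the linear form
    v_1 - bu v_0 kills eu and has norm at most 1 + |bu|. *)
Definition angle : R := `|bs - bu| / (1 + `|bu|).

Lemma angle_gt0 : 0 < angle.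
Proof.
by rewrite divr_gt0 ?normr_gt0 ?subr_eq0 ?(slope_neq fr)// ltr_wpDr.
Qed.

Lemma stable_dir_ge p : angle <= euclid (stable_dir p).
Proof.
rewrite (le_trans _ (norm_le_euclid _))// ler_pdivrMr ?ltr_wpDr//.
have -> : bs - bu = stable_dir p 0 1 - bu * stable_dir p 0 0.
  by rewrite !mxE /=; ring.
rewrite (le_trans (ler_normB _ _))// mulrDr mulr1 lerD ?coord_le_norm//.
by rewrite normrM mulrC ler_wpM2r// coord_le_norm.
Qed.

Lemma stable_splitting : splitting E1 E2.
Proof.
split=> [p|p|p].
- exists stable_dir; near=> q; split=> //; first exact: stable_dir_continuous.
  exact: frame_neq0 (stable_frame q).
- exists (cst eu); near=> q; split=> //; first exact: cst_continuous.
  by apply: frame_neq0 (frame_sym (stable_frame q)).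
- exact/frame_splitting/stable_frame.
Unshelve. all: by end_near. Qed.

Lemma coneP p v : cone E1 E2 1 p v -> exists a b,
  v = a *: stable_dir p + b *: eu /\
  `|a| * euclid (stable_dir p) <= `|b| * euclid eu.
Proof.
rewrite /cone /=; have [a [b ->]] := frame_decomp v (stable_frame p).
rewrite (frame_pil _ _ (stable_frame p)) (frame_pir _ _ (stable_frame p)).
by rewrite mul1r !euclidZ => ab; exists a, b.
Qed.

Lemma tdiff_iter_frame k p : exists2 mu : R, L ^+ k <= `|mu| &
  forall a b, tdiff (iter k f) p (a *: stable_dir p + b *: eu) =
    (a * ls ^+ k) *: stable_dir (iter k f p) + (b * mu) *: eu.
Proof.
have [mu muk E] := tdiff_iter_unstable fr c0 c1 k p.
exists mu => // a b; rewrite tdiff_linear E (tdiff_iter_stable sE) !scalerA.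
by [].
Qed.

Lemma stable_invariant : invariant_subbundle f E1.
Proof.
move=> p v /vlineP[a ->]; rewrite -[a *: _]addr0 -(scale0r eu) tdiff_linear sE.
by rewrite scale0r addr0 scalerA; apply/vlineP; eexists.
Qed.

Let K := 2 * (`|es| + C * `|eu|) / angle.

Lemma K_ge0 : 0 <= K.
Proof.
have := stable_dir_le 0; have := euclid_ge0 (stable_dir 0).
by move=> h1 h2; apply: divr_ge0; [exact: le_trans h1 h2|exact/ltW/angle_gt0].
Qed.

(** The lengths of the spanning vectors at two points are comparable, so the
    length of a stable vector is governed by its coefficient up to the factor
    K. *)
Lemma stable_ratio (p q : torus R) (a : R) :
  `|a| * euclid (stable_dir q) <= `|a| * euclid (stable_dir p) * K.
Proof.
rewrite -mulrA ler_wpM2l// (le_trans (stable_dir_le q))//.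
rewrite -[leLHS](divfK (lt0r_neq0 angle_gt0)) -/K mulrC ler_wpM2r ?K_ge0//.
exact: stable_dir_ge.
Qed.

Lemma eu_gt0 : 0 < euclid eu.
Proof.
rewrite lt_def euclid_ge0 andbT euclid_eq0.
exact: frame_neq0 (frame_sym (stable_frame 0)).
Qed.

Lemma stable_domination k : `|ls| ^+ k * K < L ^+ k -> domination f E1 E2 1 k.
Proof.
move=> kK p _ [v /coneP[a [b [-> ab]]] <-].
have [mu muk ->] := tdiff_iter_frame k p.
have [b0|b0] := eqVneq b 0; [right|left].
  move: ab; rewrite b0 normr0 mul0r => ab.
  have a0 : a = 0.
    apply/eqP; rewrite -normr_le0 -(pmulr_lle0 _ (_ : 0 < euclid (stable_dir
      p)))//.
    exact: lt_le_trans angle_gt0 (stable_dir_ge p).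
  by rewrite /= a0 !mul0r !scale0r addr0.
rewrite /strict_cone /= (frame_pil _ _ (stable_frame _)).
rewrite (frame_pir _ _ (stable_frame _)) mul1r !euclidZ !normrM normrX.
have ab' := le_trans (stable_ratio p (iter k f p) a)
  (ler_wpM2r K_ge0 ab).
apply: (@le_lt_trans _ _ (`|ls| ^+ k * (`|b| * euclid eu * K))).
  by rewrite mulrAC mulrC ler_wpM2l ?exprn_ge0.
rewrite (_ : _ ^+ k * _ = `|b| * euclid eu * (`|ls| ^+ k * K)); last by ring.
rewrite [X in _ < X]mulrAC ltr_pM2l ?mulr_gt0 ?eu_gt0 ?normr_gt0//.
exact: lt_le_trans muk.
Qed.

Lemma stable_sc k : `|ls| ^+ k * K < 2^-1 -> sc_cond f E1 k.
Proof.
move=> kK p v /vlineP[a ->]; rewrite euclidZ => a1.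
have [mu _ E] := tdiff_iter_frame k p.
have := E a 0; rewrite scale0r mul0r scale0r !addr0 => ->.
rewrite euclidZ normrM normrX (mulrC `|a|) -mulrA.
apply: le_lt_trans kK; rewrite ler_wpM2l ?exprn_ge0//.
by rewrite (le_trans (stable_ratio p _ a))// a1 mul1r.
Qed.

(** In the cone, the unstable component B of a unit vector is at least 1/4 in
    length. It is multiplied by at least L ^ k, while the stable component
    remains below B / 2. Since the sup norm is at least half of the Euclidean
    norm, 18 / 2 - 1 / 2 > 8 leaves more than 2. *)
Lemma unstable_cu k : `|ls| ^+ k * K < 2^-1 -> 18 < L ^+ k ->
  cu_cond f E1 E2 1 k.
Proof.
move=> kK kL p v /coneP[a [b [-> ab]]] v1.
have [mu muk ->] := tdiff_iter_frame k p.
set B := `|b| * euclid eu in ab *.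
have B4 : 1 <= 4 * B.
  rewrite -[X in X <= _]v1 (le_trans (euclid_le_norm _))//.
  have := ler_normD (a *: stable_dir p) (b *: eu); rewrite !normrZ.
  have := ler_wpM2l (normr_ge0 a) (norm_le_euclid (stable_dir p)).
  have := ler_wpM2l (normr_ge0 b) (norm_le_euclid eu).
  rewrite -/B => h1 h2 h3; have h4 := lerD (le_trans h2 ab) h1.
  by have := le_trans h3 h4; move: (`|_ + _|) => n h5; lra.
rewrite (lt_le_trans _ (norm_le_euclid _))//.
set w := _ *: stable_dir _; set u := _ *: eu.
have wB : `|w| <= B * (`|ls| ^+ k * K).
  rewrite (le_trans (norm_le_euclid _))// euclidZ normrM normrX.
  rewrite (mulrC `|a|) -mulrA (mulrCA B) ler_wpM2l ?exprn_ge0//.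
  by rewrite (le_trans (stable_ratio p _ a))// ler_wpM2r ?K_ge0.
have uB : L ^+ k * B <= 2 * `|u|.
  rewrite (le_trans _ (euclid_le_norm _))// euclidZ normrM.
  rewrite /B mulrA ler_wpM2r ?euclid_ge0// mulrC ler_wpM2l//.
have := lerB_normD u w; rewrite (addrC u w).
move: (`|w + u|) (`|u|) (`|w|) uB wB => n1 n2 n3 uB wB n123.
have B0 : 0 < B by lra.
have h1 : B * (`|ls| ^+ k * K) < B * 2^-1 by rewrite ltr_pM2l.
have h2 : 18 * B < L ^+ k * B by rewrite ltr_pM2r.
lra.
Qed.

End Slope.

(** Eventually in k, so that one exponent can serve all the conditions at
    once. *)
Lemma hyperbolic_splitting : exists E1 E2,
  (\forall k \near \oo, dominated_splitting f E1 E2 1 k /\ sc_cond f E1 k) /\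
  (1 < L -> \forall k \near \oo, cu_cond f E1 E2 1 k).
Proof.
have [s [cs [C sC] sE]] := stable_slope fr c0 c1 dom.
pose K := 2 * (`|es| + C * `|eu|) / angle.
have L0 : 0 < L by apply: le_lt_trans dom.
have near2 : \forall k \near \oo, `|ls| ^+ k * K < 2^-1.
  by apply: geometric_small; rewrite ?invr_gt0// normr_ge0 (ls_lt1 fr).
exists (fun p => <[stable_dir s p]>%VS), (fun=> <[eu]>%VS); split.
  have near1 : \forall k \near \oo, (`|ls| / L) ^+ k * K < 1.
    apply: geometric_small => //.
    by rewrite divr_ge0 ?(ltW L0)//= ltr_pdivrMr// mul1r.
  apply: filterS2 near1 near2 => k k1 k2; split;
    last exact: stable_sc sC sE _ k2.
  split=> //; [exact: stable_splitting|exact: stable_invariant|].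
  apply: (stable_domination sC sE).
  move: k1; rewrite expr_div_n mulrAC ltr_pdivrMr ?exprn_gt0// mul1r.
  by [].
move=> L1; have near3 : \forall k \near \oo, L^-1 ^+ k * 18 < 1.
  apply: geometric_small => //.
  by rewrite invr_ge0 (ltW L0)/= invf_lt1.
apply: filterS2 near2 near3 => k k2;
  rewrite exprVn mulrC ltr_pdivrMr ?exprn_gt0// mul1r.
exact: unstable_cu sC sE k k2.
Qed.

End Hyperbolicity.

(** * Local inverses, degree and the absence of expansion *)
Section Straightening.
Context {R : realType} (c : R) (c0 : 0 <= c) (c1 : c < 1).
Implicit Types t u y : R.

Definition bend t : R := t + dent c t.

Lemma is_derive_bend t : is_derive t 1 bend (1 + dent' c t).
Proof. by have dd := is_derive_dent c t; exact: is_deriveD. Qed.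

Lemma bend_continuous : continuous bend.
Proof.
by apply: continuous_add => [t|]; [exact: cvg_id|exact: dent_continuous].
Qed.

Lemma bend'_gt0 t : 0 < 1 + dent' c t.
Proof.
have := dent'_le t c0; rewrite ler_norml => /andP[d0 _].
have : 1 - c <= 1 + dent' c t by rewrite lerD2l.
by apply: lt_le_trans; rewrite subr_gt0.
Qed.

Lemma bend_incr t u : t < u -> bend t < bend u.
Proof.
move=> tu; have [||r _ E] := @MVT R bend (fun t => 1 + dent' c t) t u tu.
- by move=> r _; exact: is_derive_bend.
- by apply: continuous_subspaceT => r; exact: bend_continuous.
- by rewrite -subr_gt0 E mulr_gt0 ?subr_gt0// bend'_gt0.
Qed.

(** The dent is bounded by D, so y is between the values at y - D and y + D. *)
Lemma bend_surj y : exists t, bend t = y.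
Proof.
have d t : `|dent c t| <= c / (2 * pi) by exact: dent_le.
set D := c / _ in d.
have D0 : 0 <= D by exact: le_trans (d 0).
have ab : y - D <= y + D by lra.
have [||t _ E] := @IVT R bend (y - D) (y + D) y ab.
- by apply: continuous_subspaceT => r; exact: bend_continuous.
- rewrite ge_min le_max /bend.
  have := d (y - D); have := d (y + D); rewrite !ler_norml.
  move=> /andP[h1 h2] /andP[h3 h4].
  by apply/andP; split; apply/orP; [left|right]; lra.
- by exists t.
Qed.

Definition unbend y : R := projT1 (cid (bend_surj y)).

Lemma unbendK : cancel unbend bend.
Proof. by move=> y; rewrite /unbend; case: cid. Qed.

Lemma bendK : cancel bend unbend.
Proof.
move=> t; have := unbendK (bend t); move: (unbend _) => u ut.
by apply/eqP; case: (ltgtP u t) => // /bend_incr; rewrite ut ltxx.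
Qed.

Lemma unbend_continuous : continuous unbend.
Proof.
move=> y; rewrite -(unbendK y).
have := @near_can_continuous R bend unbend (unbend y).
move=> h; apply: nbhs_singleton (h _ _); first by near=> t; exact: bendK.
by near=> t; exact: bend_continuous.
Unshelve. all: by end_near. Qed.

Lemma is_derive_unbend y : is_derive y 1 unbend (1 + dent' c (unbend y))^-1.
Proof.
rewrite -{1}(unbendK y); apply: is_derive_inverse.
- by near=> t; exact: bendK.
- by near=> t; exact: bend_continuous.
- exact: is_derive_bend.
- exact/lt0r_neq0/bend'_gt0.
Unshelve. all: by end_near. Qed.

End Straightening.

Section Endomorphism.
Context {R : realType} (A : 'M[int]_2) (ls lu bs bu c : R).
Context (fr : eigenframe A ls lu bs bu) (detA : 2 <= `|\det A|).
Context (c0 : 0 <= c) (c1 : c < 1) (dom : `|ls| < `|lu| * (1 - c)).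
Implicit Types (x y z v : 'rV[R]_2) (p q : torus R).

Local Notation eu := (row2 1 bu : 'rV[R]_2).
Local Notation F := (dlift A lu bu c).
Local Notation f := (dmap A lu bu c).
Local Notation tau := (unbend c0).

Definition shear x : 'rV[R]_2 := x + dent c (x 0 0) *: eu.
Definition unshear x : 'rV[R]_2 := x + (tau (x 0 0) - x 0 0) *: eu.

Lemma unshear0 x : unshear x 0 0 = tau (x 0 0).
Proof. by rewrite !mxE /= mulr1 addrC subrK. Qed.

Lemma unshearK : cancel unshear shear.
Proof.
move=> x; rewrite /shear unshear0 /unshear -addrA -scalerDl addrAC.
by rewrite -/(bend c _) (unbendK c0) subrr scale0r addr0.
Qed.

Lemma shearK : cancel shear unshear.
Proof.
move=> x; rewrite /unshear.
have -> : shear x 0 0 = bend c (x 0 0) by rewrite !mxE /= mulr1.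
rewrite (bendK c0 c1) /shear -addrA -scalerDl /bend.
rewrite (_ : dent c _ + _ = 0) ?scale0r ?addr0//; last by ring.
Qed.

(** Multiplying eu by lu is applying A to it. *)
Lemma dlift_shear x : F x = shear x *m torusmx A.
Proof.
by rewrite /shear mulmxDl -scalemxAl (unstable_eig fr) scalerA mulrC.
Qed.

Lemma torusmx_unit : torusmx A \in (@unitmx R 2).
Proof.
rewrite unitmxE unitfE det_tr det_map_mx intr_eq0.
by apply: contraTneq detA => ->.
Qed.

Definition dinv y : 'rV[R]_2 := unshear (y *m invmx (torusmx A)).

Lemma dinvK : cancel dinv F.
Proof. by move=> y; rewrite dlift_shear unshearK mulmxKV// torusmx_unit. Qed.

Lemma dliftK : cancel F dinv.
Proof. by move=> x;
  rewrite dlift_shear /dinv mulmxK ?torusmx_unit// shearK. Qed.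

Lemma dinv_ridge : dinv = ridge (invmx (torusmx A))
  (\row_i invmx (torusmx A) i 0) (fun t => tau t - t) eu 0.
Proof.
apply/funext => y; rewrite /dinv /unshear /ridge addr0.
have -> // : (y *m invmx (torusmx A)) 0 0 =
  lform (\row_i invmx (torusmx A) i 0) y.
rewrite /lform !mxE big_ord_recl big_ord1.
have -> : lift ord0 ord0 = 1 :> 'I_2 by apply: val_inj.
by rewrite [y 0 0 * _]mulrC [y 0 1 * _]mulrC.
Qed.

(** The lift is globally invertible. Around a point the inverse on the torus is
    the projection of the inverse of the lift, taken on the representative
    closest to the image of that point; it is C^1 since the inverse of the lift
    is a ridge whose profile is, up to a linear term, the inverse of a function
    with nonzero derivative. *)
Lemma dmap_local_diffeo : local_diffeo f.
Proof.
move=> p; pose x := repr p.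
pose S : set 'rV[R]_2 := [set y | `|y - F x| < 2^-1].
have oS : open S.
  rewrite (_ : S = ball (F x) 2^-1); first exact: ball_open.
  by rewrite -ball_normE; apply/funext => y /=; rewrite /S /= distrC.
have Sx : S (F x) by rewrite /S /= subrr normr0.
have fU : f @` (@tproj R @` (F @^-1` S)) = @tproj R @` S.
  apply/seteqP; split=> [_ [_ [z Sz <-] <-]|_ [y Sy <-]].
    by exists (F z) => //; rewrite (dmap_tproj A).
  exists (tproj (dinv y)); last by rewrite (dmap_tproj A) dinvK.
  by exists (dinv y) => //; rewrite /preimage /= dinvK.
exists (@tproj R @` (F @^-1` S)), (fun q => tproj (dinv (F x + tlog (q - f
  p)))).
have gS y : S y -> tproj (dinv (F x + tlog (tproj y - f p))) = tproj (dinv y).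
  by move=> Sy; rewrite -tprojB tlog_small// addrC subrK.
split.
- split; last by exists x; rewrite ?tprojK.
  apply: tproj_open; apply: open_comp oS => ? _; exact: dlift_continuous.
- by rewrite fU; exact: tproj_open.
- by move=> q _; exact: tCk_dmap.
- move=> q; rewrite fU => -[y Sy <-].
  apply: (@tCk1_ridge _ _ y (invmx (torusmx A)) (\row_i invmx (torusmx A) i 0)
    (fun t => tau t - t) (fun t => (1 + dent' c (tau t))^-1 - 1) eu 0).
  + rewrite -dinv_ridge; have : \forall z \near y, S z by move: oS;
    rewrite openE; exact.
    by apply: filterS => z; exact: gS.
  + move=> t; have dt := is_derive_unbend c0 c1 t; exact: is_deriveB.
  + have cs : continuous (fun t => 1 + dent' c (tau t)).
      apply: continuous_add => [u|u]; first exact: cvg_cst.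
      apply: (@continuous_comp _ _ _ tau (dent' c));
        first exact: unbend_continuous.
      exact: dent'_continuous.
    apply: continuous_add => t; last exact: cvg_cst.
    apply: (@continuousV R R (fun t => 1 + dent' c (tau t))); last exact: cs.
    exact/lt0r_neq0/bend'_gt0.
- by move=> _ [z Sz <-]; rewrite (dmap_tproj A) gS// dliftK.
Qed.

(** Otherwise the inverse of A would be an integral matrix, and its determinant
    an integer of modulus between 0 and 1/2. A vector such as w represents a
    nonzero point in the kernel of A on the torus. *)
Lemma nonintegral_preimage : exists2 w : 'rV[R]_2,
  w \notin @Z2 R & w *m torusmx A \in @Z2 R.
Proof.
pose N : 'M[R]_2 := invmx (torusmx A).
have [NZ|] := pselect (forall i, row i N \in @Z2 R); last first.
  move=> /existsNP[i /negP wZ]; exists (row i N) => //.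
  rewrite -row_mul mulVmx ?torusmx_unit// Z2E !mxE.
  by rewrite !rpred_nat.
have detN : \det N \is a Num.int.
  apply: rpred_sum => s _; apply: rpredM;
    first by rewrite rpredX// rpredN rpred1.
  apply: rpred_prod => i _; have := NZ i; rewrite inE => /mxOverP/(_ 0 (s i)).
  by rewrite mxE.
have detAN : (\det A)%:~R * \det N = 1 :> R.
  by rewrite -det_map_mx -det_tr -det_mulmx mulmxV ?torusmx_unit// det1.
have N0 : \det N != 0 by apply: contra_eq_neq detAN => ->;
  rewrite mulr0 eq_sym oner_neq0.
have detA2 : 2 <= `|(\det A)%:~R : R| by rewrite -intr_norm (ler_int R 2).
have : \det N = 0.
  apply: int_lt1_eq0 => //; have : `|(\det A)%:~R| * `|\det N| = 1.
    by rewrite -normrM detAN normr1.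
  move: `|_%:~R| `|\det N| detA2 (normr_ge0 (\det N)) => a b; nra.
by move=> N0'; rewrite N0' eqxx in N0.
Qed.

Lemma dlift0 : F 0 = 0.
Proof. by rewrite /dlift mul0mx mxE dent0 mulr0 scale0r addr0. Qed.

Lemma dmap0 : f 0 = 0.
Proof. by rewrite -tproj0 (dmap_tproj A) dlift0. Qed.

(** The shear is a bijection commuting with lattice translations, so
    injectivity would pass from the map to A, whose kernel on the torus is
    nontrivial. *)
Lemma dmap_not_bijective : ~ bijective f.
Proof.
move=> /bij_inj finj; have [w wZ AwZ] := nonintegral_preimage.
have : tproj (unshear w) = 0.
  apply: finj; rewrite dmap0 (dmap_tproj A) dlift_shear unshearK -tproj0.
  by apply/tprojP; rewrite subr0.
rewrite -tproj0 => /tprojP; rewrite subr0 => uZ.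
have /andP[tZ _] : (tau (w 0 0) \is a Num.int) && (unshear w 0 1 \is a Num.int).
  by rewrite -unshear0 -Z2E.
have tw : tau (w 0 0) = w 0 0.
  rewrite -{2}(unbendK c0 (w 0 0)) /bend (@dent_shift _ _ _ 0) ?subr0//.
  by rewrite dent0 addr0.
by move: uZ wZ; rewrite /unshear tw subrr scale0r addr0 => ->.
Qed.

(** At the fixed point 0 the stable direction is an eigenvector of every
    iterate, for an eigenvalue of modulus at most 1. *)
Lemma dmap_not_expanding : ~ expanding f.
Proof.
move=> [k kexp].
have [s [_ _ sE]] := stable_slope fr c0 c1 dom.
have e0 : 0 < euclid (stable_dir bs bu s 0).
  by apply: lt_le_trans (angle_gt0 fr) _; exact: stable_dir_ge.
have f0 : iter k f 0 = 0 by elim: k {kexp} => //= k ->; exact: dmap0.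
have e1 : euclid ((euclid (stable_dir bs bu s 0))^-1 *: stable_dir bs bu s 0) =
  1.
  by rewrite euclidZ ger0_norm ?invr_ge0 ?ltW// mulVf// gt_eqF.
have := kexp 0 _ e1.
rewrite -[X in tdiff _ _ X]addr0 -(scale0r eu) tdiff_linear scale0r addr0.
rewrite (tdiff_iter_stable sE) f0 scalerA mulrC -scalerA euclidZ e1.
rewrite mulr1 normrX ltNge.
by rewrite exprn_ile1// ltW// (ls_lt1 fr).
Qed.

Lemma dmap_endomorphism : endomorphism f.
Proof.
split; [exact: dmap_local_diffeo|exact: dmap_not_bijective|].
exact: dmap_not_expanding.
Qed.

End Endomorphism.

(** * Homotopies and the semi-conjugacy *)
Section Homotopy.
Context {R : realType}.
Implicit Types (x y v : 'rV[R]_2) (p q : torus R) (g h : torus R -> torus R).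

(** Addition of a multiple of a fixed direction: the perturbed map is a drift
    of the linear one, and the semi-conjugacy a drift of the identity. *)
Definition drift g (u : torus R -> R) v p : torus R := g p + tproj (u p *: v).

Lemma lift_drift_continuous (Y : topologicalType) (G : Y -> 'rV[R]_2)
    (u : Y -> R) v : continuous G -> continuous u ->
  continuous (fun z => tproj (G z + u z *: v)).
Proof.
move=> cG cu z;
  apply: (@continuous_comp _ _ _ (fun z => G z + u z *: v) (@tproj R)).
  by apply: cvgD; [exact: cG|apply: cvgZr_tmp; exact: cu].
exact: tproj_continuous.
Qed.

(** The amount of drift is scaled down linearly. *)
Lemma homotopic_drift g G (u : torus R -> R) v :
  (forall x, g (tproj x) = tproj (G x)) -> continuous G -> continuous u ->
  homotopic (drift g u v) g.
Proof.
move=> gG cG cu; exists (fun z => drift g (fun p => (1 - z.1) * u p) v z.2);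
  split.
- apply: continuous_subspaceT.
  apply: (torus_continuous2 (F := fun z : R * 'rV[R]_2 =>
    tproj (G z.2 + ((1 - z.1) * u (tproj z.2)) *: v))) => [t x /=|].
    by rewrite /drift gG -tprojD.
  apply: lift_drift_continuous => [z|].
    by apply: (@continuous_comp _ _ _ snd G); [exact: cvg_snd|exact: cG].
  apply: continuous_mul => z.
    by apply: cvgB; [exact: cvg_cst|exact: cvg_fst].
  apply: (@continuous_comp _ _ _ snd (u \o @tproj R)); first exact: cvg_snd.
  by apply: continuous_comp; [exact: tproj_continuous|exact: cu].
- by move=> p; rewrite /drift /= subr0 mul1r.
- by move=> p; rewrite /drift /= subrr mul0r scale0r tproj0 addr0.
Qed.

Lemma drift_continuous g G (u : torus R -> R) v :
  (forall x, g (tproj x) = tproj (G x)) -> continuous G -> continuous u ->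
  continuous (drift g u v).
Proof.
move=> gG cG cu; apply: torus_continuous.
have -> : drift g u v \o @tproj R = fun x => tproj (G x + u (tproj x) *: v).
  by apply/funext => x /=; rewrite /drift gG -tprojD.
apply: lift_drift_continuous => // x.
by apply: continuous_comp; [exact: tproj_continuous|exact: cu].
Qed.

(** On a line in the direction v the drift is t |-> t + u, a bounded
    perturbation of the identity of the real line, hence onto by the
    intermediate value theorem. *)
Lemma drift_surj (u : torus R -> R) (C : R) v : continuous u ->
  (forall p, `|u p| <= C) -> range (drift id u v) = [set: torus R].
Proof.
move=> cu uC; apply/seteqP; split=> // q _; rewrite -(tprojK q);
  set y := repr q.
pose w (t : R) := t + u (tproj (y + t *: v)).
have cw : continuous w.
  apply: continuous_add => t; first exact: cvg_id.
  apply: (@continuous_comp _ _ _ (fun t : R => tproj (y + t *: v)) u);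
    last exact: cu.
  apply: (@continuous_comp _ _ _ (fun t : R => y + t *: v) (@tproj R)).
    by apply: cvgD; [exact: cvg_cst|apply: cvgZr_tmp; exact: cvg_id].
  exact: tproj_continuous.
have C0 : 0 <= C by exact: le_trans (uC 0).
have ab : - C <= C by lra.
have [||t _ E] := @IVT R w (- C) C 0 ab.
- by apply: continuous_subspaceT.
- rewrite ge_min le_max /w.
  have := uC (tproj (y + - C *: v)); have := uC (tproj (y + C *: v)).
  rewrite !ler_norml => /andP[h1 h2] /andP[h3 h4].
  by apply/andP; split; apply/orP; [left|right]; lra.
exists (tproj (y + t *: v)) => //.
by rewrite /drift /= -tprojD -addrA -scalerDl -/(w t) E scale0r addr0.
Qed.

End Homotopy.

Section SemiConjugacy.
Context {R : realType} (A : 'M[int]_2) (ls lu bs bu c : R).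
Context (fr : eigenframe A ls lu bs bu) (c0 : 0 <= c).
Implicit Types (x y v : 'rV[R]_2) (p q : torus R).

Local Notation eu := (row2 1 bu : 'rV[R]_2).
Local Notation f := (dmap A lu bu c).

Lemma dmap_homotopic : homotopic f (@toral_linear R A).
Proof.
have -> : f = drift (@toral_linear R A) (fun p => lu * dent c (repr p 0 0)) eu.
  apply/funext => p; rewrite /drift -{2}(tprojK p).
  by rewrite (toral_linear_tproj A lu bu) -tprojD.
apply: homotopic_drift.
- exact: (toral_linear_tproj A lu bu).
- exact: mulmxr_continuous.
- apply: continuous_scal.
  exact: periodic_repr_continuous (@dent_continuous R c) (@dent_shift R c).
Qed.

(** Comparing unstable components, h o f = A o h for h = id + u eu reads u =
    dent + (u o f) / lu; the stable components agree since the perturbation is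
    along eu. *)
Lemma dmap_semi_conjugacy : exists h,
  semi_conjugacy h f (@toral_linear R A) /\ homotopic h id.
Proof.
have lu0 : lu != 0 by rewrite -normr_gt0 (lt_trans _ (lu_gt1 fr)).
have [] := @cocycle_solution R (torus R) f (fun=> lu^-1)
  (fun p => dent c (repr p 0 0)) `|lu|^-1 (c / (2 * pi)).
- exact: dmap_continuous.
- exact: cst_continuous.
- exact: periodic_repr_continuous (@dent_continuous R c) (@dent_shift R c).
- by rewrite invr_ge0 normr_ge0 invf_lt1 ?normr_gt0// (lu_gt1 fr).
- by move=> p; rewrite normfV.
- by move=> p; exact: dent_le.
move=> u [cu uE uC]; exists (drift id u eu); split; last first.
  by apply: (@homotopic_drift _ id id) => // ?; exact: cvg_id.
split; first by apply: (@drift_continuous _ id id) => // ?; exact: cvg_id.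
  exact: drift_surj uC.
apply/funext => p /=; rewrite -(tprojK p); set x := repr p.
rewrite (dmap_tproj A) /drift /= -!tprojD (toral_linear_tproj A lu bu).
congr tproj;
  rewrite [u (tproj x)]uE (dmap_tproj A) mulmxDl -scalemxAl (unstable_eig fr).
rewrite scalerA /dlift -addrA -scalerDl; congr (_ + _ *: _).
by rewrite (dent_shift c (repr_tproj x)); field.
Qed.

End SemiConjugacy.

(** * The sink and the failure of injectivity *)
Section PlaneNotLine.
Context {R : realType}.

(** The real-valued case of the Borsuk-Ulam theorem: the path g leads from a
    point to its opposite without meeting 0, so K (g t) - K (- g t) changes
    sign and vanishes somewhere. *)
Lemma no_injection_into_line (K : 'rV[R]_2 -> R) (d : R) : 0 < d ->
  (forall x, `|x| < d -> {for x, continuous K}) ->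
  exists x y, [/\ `|x| < d, `|y| < d, x != y & K x = K y].
Proof.
move=> d0 cK; pose r := d / 2; have r0 : 0 < r by rewrite divr_gt0.
pose g (t : R) : 'rV[R]_2 := row2 (r * (1 - 2 * t)) (r * (t * (1 - t))).
have g0 t : g t = - g t -> False.
  move=> E; have := congr1 (fun v : 'rV_2 => v 0 0) E.
  have := congr1 (fun v : 'rV_2 => v 0 1) E; rewrite !mxE /=.
  move=> /eqP; rewrite -subr_eq0 opprK -mulr2n mulrn_eq0 /= mulf_eq0 gt_eqF//=.
  move=> h1 /eqP;
    rewrite -subr_eq0 opprK -mulr2n mulrn_eq0 /= mulf_eq0 gt_eqF//=.
  rewrite subr_eq0 => /eqP h2; move: h1; rewrite mulf_eq0 subr_eq0.
  by move=> /orP[] /eqP h3; move: h2; rewrite -?h3; lra.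
have gd t : t \in `[0, 1] -> `|g t| < d.
  rewrite in_itv /= => /andP[t0 t1]; have rd : r < d by rewrite /r; lra.
  have rM u : `|u| <= 1 -> `|r * u| <= r.
    by move=> u1; rewrite normrM (gtr0_norm r0) ger_pMr.
  rewrite (le_lt_trans _ rd)// norm_row2 ge_max /g !row2E.
  by apply/andP; split; apply: rM; rewrite ler_norml; apply/andP; split; nra.
pose D t := K (g t) - K (- g t).
have cg : continuous g.
  apply: continuous_row2; apply: continuous_scal.
    apply: continuous_add => [t|t]; first exact: cvg_cst.
    by apply: cvgN; apply: cvgMl_tmp; exact: cvg_id.
  apply: continuous_mul => [t|]; first exact: cvg_id.
  by apply: continuous_add => t; [exact: cvg_cst|apply: cvgN; exact: cvg_id].
have cD : {within `[(0:R), 1], continuous D}.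
  apply: continuous_in_subspaceT => t; rewrite inE /= => t01.
  have t01' : t \in `[0, 1] by [].
  have gdt := gd _ t01'.
  have cK1 : {for t, continuous (K \o g)}.
    by apply: continuous_comp; [exact: cg|exact: cK].
  have cK2 : {for t, continuous (K \o (fun t => - g t))}.
    by apply: continuous_comp; [apply: continuousN; exact: cg|apply: cK;
      rewrite normrN].
  exact: (continuousB cK1 cK2).
have g1 : g 1 = - g 0.
  by apply: eq_row2; rewrite !mxE /=; ring.
have D1 : D 1 = - D 0 by rewrite /D g1 opprK opprB.
have [|t t01 E] := @IVT R D 0 1 0 ler01 cD.
  rewrite D1 ge_min le_max; case: (leP (D 0) 0) => h;
    rewrite ?orbT ?oppr_ge0 ?h ?orbT//=.
  by rewrite oppr_le0 (ltW h).
exists (g t), (- g t); split; rewrite ?normrN ?gd//.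
  by apply/eqP => /g0.
by apply/eqP; rewrite -subr_eq0; apply/eqP.
Qed.

End PlaneNotLine.

Section Sink.
Context {R : realType} (A : 'M[int]_2) (ls lu bs bu c : R).
Context (fr : eigenframe A ls lu bs bu).
Context (c0 : 0 <= c) (c1 : c < 1) (sink : `|lu| * (1 - c) < 1).
Implicit Types (x y v : 'rV[R]_2) (p q : torus R).

Local Notation es := (row2 1 bs : 'rV[R]_2).
Local Notation eu := (row2 1 bu : 'rV[R]_2).
Local Notation F := (dlift A lu bu c).
Local Notation f := (dmap A lu bu c).

(** Coordinates in the basis es, eu. *)
Definition scoord x : R := (x 0 1 - bu * x 0 0) / (bs - bu).
Definition ucoord x : R := (bs * x 0 0 - x 0 1) / (bs - bu).

Let slope0 : bs - bu != 0. Proof. by rewrite subr_eq0 (slope_neq fr). Qed.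

Lemma coord_decomp x : x = scoord x *: es + ucoord x *: eu.
Proof.
by apply: eq_row2; rewrite !mxE /= /scoord /ucoord; field.
Qed.

Lemma scoordE a b : scoord (a *: es + b *: eu) = a.
Proof. by rewrite /scoord !mxE /=; field. Qed.

Lemma ucoordE a b : ucoord (a *: es + b *: eu) = b.
Proof. by rewrite /ucoord !mxE /=; field. Qed.

Lemma coord_mulmx x :
  x *m torusmx A = (ls * scoord x) *: es + (lu * ucoord x) *: eu.
Proof.
rewrite {1}[x]coord_decomp mulmxDl -!scalemxAl (stable_eig fr) (unstable_eig
  fr).
by rewrite !scalerA; congr (_ *: _ + _ *: _); rewrite mulrC.
Qed.

Lemma ucoord_mulmx x : ucoord (x *m torusmx A) = lu * ucoord x.
Proof. by rewrite coord_mulmx ucoordE. Qed.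

Lemma coord_dlift x : F x =
  (ls * scoord x) *: es + (lu * (ucoord x + dent c (x 0 0))) *: eu.
Proof. by rewrite /dlift coord_mulmx -addrA -scalerDl mulrDr. Qed.

Lemma scoord_continuous : continuous scoord.
Proof.
have -> : scoord = lform (row2 (- bu / (bs - bu)) (bs - bu)^-1).
  by apply/funext => x; rewrite /scoord /lform !row2E; field.
exact: lform_continuous.
Qed.

Lemma ucoord_continuous : continuous ucoord.
Proof.
have -> : ucoord = lform (row2 (bs / (bs - bu)) (- (bs - bu)^-1)).
  by apply/funext => x; rewrite /ucoord /lform !row2E; field.
exact: lform_continuous.
Qed.

Lemma near_small (g : 'rV[R]_2 -> R) e : continuous g -> g 0 = 0 -> 0 < e ->
  \forall x \near (0 : 'rV[R]_2), `|g x| < e.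
Proof.
move=> cg g0 e0; have /cvgrPdist_lt/(_ _ e0) := cg 0.
by apply: filterS => x /=; rewrite g0 sub0r normrN.
Qed.

Lemma dent_tangent e : 0 < e ->
  exists2 r, 0 < r & forall t, `|t| < r -> `|dent c t + c * t| <= e * `|t|.
Proof.
move=> e0; have [/cvgrPdist_lt/(_ _ e0) + E] := is_derive_dent c 0.
rewrite -/('D_1 (dent c) 0) E => /nbhs_ballP[r /= r0 H]; exists r => // t tr.
have [->|t0] := eqVneq t 0; first by rewrite dent0 mulr0 addr0 !normr0 mulr0.
have := H t; rewrite -ball_normE /= sub0r normrN => /(_ tr t0).
rewrite dent'0 dent0 subr0 addr0 /GRing.scale /= mulr1 => h.
have -> : dent c t + c * t = - ((- c - t^-1 * dent c t) * t) by field.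
by rewrite normrN normrM ler_wpM2r// ltW.
Qed.

(** In the coordinates along es and eu the linear part at 0 is triangular with
    diagonal ls, lu (1 - c). Since the off-diagonal entry - lu c need not be
    small, the invariant boxes are made thin in the stable direction, by a
    factor k which also absorbs the nonlinear error. *)
Lemma sink_basin (W : set 'rV[R]_2) : nbhs (0 : 'rV[R]_2) W ->
  exists V, [/\ nbhs (0 : 'rV[R]_2) V, V `<=` W & forall x, V x -> V (F x)].
Proof.
move=> /nbhs_row2[w w0 wW].
set l := `|lu|; have l1 : 1 < l := lu_gt1 fr.
(* Per unit of the box, the stable width and the two error terms contribute at
   most 3 l k to the image, which fills the gap between l (1 - c) and 1. *)
pose k := (1 - l * (1 - c)) / (3 * l).
have k0 : 0 < k by rewrite divr_gt0 ?subr_gt0// mulr_gt0// (lt_trans _ l1).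
have l0 : l != 0 by rewrite gt_eqF// (lt_trans _ l1).
have lk : 3 * (l * k) = 1 - l * (1 - c) by rewrite /k; field.
have k1 : k <= 1.
  have lp : 0 < l by exact: lt_trans l1.
  rewrite -(ler_pM2l lp) mulr1.
  have : 0 <= l * (1 - c) by rewrite mulr_ge0 ?subr_ge0// ltW.
  lra.
have [r r0 rD] := dent_tangent k0.
pose N := `|es| + `|eu| + 1.
have N0 : 0 < N by rewrite ltr_wpDl// addr_ge0.
pose d := Num.min (r / 2) (w / N).
have d0 : 0 < d by rewrite lt_min !divr_gt0.
have dr : d * 2 <= r by rewrite -ler_pdivlMr// ge_min lexx.
have dw : d * N <= w by rewrite -ler_pdivlMr// ge_min lexx orbT.
have dk0 : 0 < d * k by exact: mulr_gt0.
have dkd : d * k <= d by rewrite ger_pMr.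
exists [set x | `|scoord x| < d * k /\ `|ucoord x| < d]; split.
- have s0 : scoord 0 = 0 by rewrite /scoord !mxE mulr0 subr0 mul0r.
  have u0 : ucoord 0 = 0 by rewrite /ucoord !mxE mulr0 subr0 mul0r.
  by apply: filterI; [exact: near_small scoord_continuous s0 dk0|
    exact: near_small ucoord_continuous u0 d0].
- move=> x /= [xs xu]; rewrite -[x]add0r; apply: wW; apply: lt_le_trans dw.
  rewrite {1}[x]coord_decomp (le_lt_trans (ler_normD _ _))//.
  rewrite (normrZ (scoord x)) (normrZ (ucoord x)).
  have h1 : `|scoord x| * `|es| <= d * `|es|.
    by rewrite ler_wpM2r// ltW// (lt_le_trans xs).
  have h2 : `|ucoord x| * `|eu| <= d * `|eu| by rewrite ler_wpM2r// ltW.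
  apply: le_lt_trans (lerD h1 h2) _; by rewrite -mulrDr ltr_pM2l// /N ltrDl.
- move=> x /= [xs xu];
  rewrite coord_dlift scoordE ucoordE (normrM ls) (normrM lu) -/l.
  split; first by rewrite (le_lt_trans _ xs)// ler_piMl// ltW// (ls_lt1 fr).
  have x0 : x 0 0 = scoord x + ucoord x.
    by rewrite {1}[x]coord_decomp !mxE /= !mulr1.
  set a := scoord x in xs x0 *; set b := ucoord x in xs xu x0 *.
  have t_le : `|x 0 0| <= `|a| + `|b| by rewrite x0 ler_normD.
  have tr : `|x 0 0| < r.
    rewrite (le_lt_trans t_le)// (lt_le_trans _ dr)// mulr_natr mulr2n ltrD//.
    exact: lt_le_trans dkd.
  have E : `|b + dent c (x 0 0)| <= (1 - c) * `|b| + `|a| + k * (`|a| + `|b|).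
    have -> : b + dent c (x 0 0) = (1 - c) * b + - (c * a) + (dent c (x 0 0) +
      c * x 0 0).
      by move: (dent c (x 0 0)) => D; rewrite x0; ring.
    rewrite (le_trans (ler_normD _ _))// lerD//; last first.
      by rewrite (le_trans (rD _ tr))// ler_wpM2l// ltW.
    rewrite (le_trans (ler_normD _ _))// normrN (normrM c) (normrM (1 - c)).
    rewrite (ger0_norm c0) (@ger0_norm _ (1 - c)) ?subr_ge0 ?(ltW c1)//.
    by rewrite lerD2l ler_piMl// ltW.
  have lp : 0 < l by exact: lt_trans l1.
  apply: (@le_lt_trans _ _ (l * ((1 - c) * `|b| + `|a| + k * (`|a| + `|b|)))).
    by rewrite ler_pM2l.
  have h1 : l * (1 - c) * `|b| <= l * (1 - c) * d.
    by rewrite ler_wpM2l ?(ltW xu)// mulr_ge0 ?subr_ge0// ltW.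
  have h2 : l * `|a| < l * (d * k) by rewrite ltr_pM2l.
  have h3 : l * k * (`|a| + `|b|) <= l * k * (d + d).
    have lk0 : 0 <= l * k by apply: mulr_ge0; exact: ltW.
    by apply: ler_wpM2l => //; apply: lerD;
      [exact/ltW/(lt_le_trans xs)|exact: ltW].
  have h4 : 3 * (l * k) * d = (1 - l * (1 - c)) * d by rewrite lk.
  move: h1 h2 h3 h4; move: (`|a|) (`|b|) => na nb; lra.
Qed.

(** Near the sink, h read in a chart around h 0 intertwines the map with the
    matrix, and its values remain bounded along orbits. As the unstable
    coordinate is multiplied by lu at each step, it vanishes. Only the stable
    coordinate remains, and it cannot be injective on a disc. *)
Lemma semi_conjugacy_not_injective h :
  semi_conjugacy h f (@toral_linear R A) -> ~ injective h.
Proof.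
move=> [ch _ hf] hinj.
have hfE p : h (f p) = toral_linear A (h p) by exact: (congr1 (@^~ p) hf).
pose y0 := repr (h 0).
have y0E : tproj y0 = h 0 by exact: tprojK.
have Ay0 : tproj (y0 *m torusmx A) = tproj y0.
  by rewrite y0E -(toral_linear_tproj A lu bu) y0E -hfE dmap0.
(* h read in the chart centred at the image of the sink *)
pose K x := tlog (h (tproj x) - tproj y0).
have [e [e0 e2 eA]] : exists e, [/\ 0 < e, e <= 2^-1 &
    forall v : 'rV[R]_2, `|v| < e -> `|v *m torusmx A| < 2^-1].
  have B : nbhs (mulmxr (torusmx A) (0 : 'rV[R]_2)) [set v | `|v| < 2^-1].
    by rewrite /= mul0mx; apply/nbhs_row2; exists 2^-1 => // v; rewrite add0r.
  have B' := @mulmxr_continuous R (torusmx A) 0 _ B;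
    have /nbhs_row2[e e0 H] : nbhs (0 : 'rV[R]_2)
    [set v | `|v *m torusmx A| < 2^-1] by exact: B'.
  exists (Num.min e 2^-1); split; first by rewrite lt_min e0 /= invr_gt0 ltr0n.
    by rewrite ge_min lexx orbT.
  by move=> v; rewrite lt_min => /andP[ve _]; have := H v ve; rewrite /= add0r.
pose W : set 'rV[R]_2 := [set x | (exists2 y, h (tproj x) = tproj y & `|y - y0|
  < e)
  /\ `|x| < 2^-1].
have W0 : nbhs (0 : 'rV[R]_2) W.
  apply: filterI; last by apply/nbhs_row2; exists 2^-1 => // v; rewrite add0r.
  have By : nbhs y0 [set y | `|y - y0| < e].
    by apply/nbhs_row2; exists e => // v /=; rewrite addrAC subrr add0r.
  have := nbhs_tproj By; rewrite y0E -{1}tproj0 => /ch/tproj_continuous H.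
  have : \forall x \near (0 : 'rV[R]_2), (@tproj R @` [set y | `|y - y0| < e])
    (h (tproj x)).
    exact: H.
  by apply: filterS => x [y ye <-]; exists y.
have [V [V0 VW VF]] := sink_basin W0.
have KW x : W x -> h (tproj x) = tproj (y0 + K x) /\ `|K x| < e.
  move=> [[y hy ye] _]; rewrite /K hy -tprojB tlog_small ?(lt_le_trans ye)//.
  by rewrite subrKC.
have KF x : V x -> K (F x) = K x *m torusmx A.
  move=> Vx; have [hx Kx] := KW x (VW _ Vx).
  rewrite {1}/K -(dmap_tproj A) hfE hx (toral_linear_tproj A lu bu) mulmxDl.
  by rewrite tprojD Ay0 addrC addKr tlog_small// eA.
have Kn x n : V x -> V (iter n F x) /\ K (iter n F x) = iter n (mulmxr (torusmx
  A)) (K x).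
  move=> Vx; elim: n => //= n [Vn Kn]; split; first exact: VF.
  by rewrite KF// Kn.
have uK x : V x -> ucoord (K x) = 0.
  move=> Vx; have lu0 : 0 < `|lu| by rewrite (lt_trans _ (lu_gt1 fr)).
  apply/eqP; rewrite -normr_le0.
  pose B := (`|bs| + 1) * e / `|bs - bu|.
  have uB v : `|v| < e -> `|ucoord v| <= B.
    move=> ve; rewrite normrM normfV ler_wpM2r ?invr_ge0//.
    rewrite (le_trans (ler_normB _ _))// mulrDl mul1r normrM lerD//.
      by rewrite ler_wpM2l// (le_trans (coord_le_norm _ _))// ltW.
    by rewrite (le_trans (coord_le_norm _ _))// ltW.
  apply: (@geometric_le0 _ `|lu|^-1 B).
    by rewrite invr_ge0 normr_ge0 invf_lt1// (lu_gt1 fr).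
  move=> n; have [Vn En] := Kn x n Vx; have [_ /uB] := KW _ (VW _ Vn).
  rewrite En; have -> : ucoord (iter n (mulmxr (torusmx A)) (K x)) =
      lu ^+ n * ucoord (K x).
    elim: n {Vn En} => [|n IH] /=; first by rewrite mul1r.
    by rewrite ucoord_mulmx IH exprS mulrA.
  by rewrite exprVn ler_pdivlMl ?exprn_gt0// -normrX -normrM.
have [d d0 dV] := (nbhs_row2 _ _).1 V0.
have dV' x : `|x| < d -> V x by move=> /dV; rewrite add0r.
have cK x : `|x| < d -> {for x, continuous (scoord \o K)}.
  move=> xd; apply: continuous_comp; last exact: scoord_continuous.
  have [[y hy ye] _] := VW _ (dV' _ xd).
  apply: (@continuous_comp _ _ _ (h \o @tproj R) (fun p => tlog (p - tproj
    y0))).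
    by apply: continuous_comp; [exact: tproj_continuous|exact: ch].
  by rewrite /= hy; apply: tlog_continuous; exact: lt_le_trans ye _.
have [x [x' [xd xd' /eqP xx' Exx']]] := no_injection_into_line d0 cK.
apply: xx'.
have EK : K x = K x'.
  rewrite [K x]coord_decomp [K x']coord_decomp (uK _ (dV' _ xd)) (uK _ (dV' _
    xd')).
  by have /= -> := Exx'.
have hxx' : h (tproj x) = h (tproj x').
  have [-> _] := KW x (VW _ (dV' _ xd));
    have [-> _] := KW x' (VW _ (dV' _ xd')).
  by rewrite EK.
have [_ x2] := VW _ (dV' _ xd); have [_ x2'] := VW _ (dV' _ xd').
by rewrite -[x]tlog_small// -[x']tlog_small// (hinj _ _ hxx').
Qed.

End Sink.

(** * Choice of the parameter *)
Lemma dmap_sc_partially_hyperbolic (R : realType) (A : 'M[int]_2)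
    (ls lu bs bu c : R) : eigenframe A ls lu bs bu -> 2 <= `|\det A| ->
  0 <= c -> c < 1 -> `|ls| < `|lu| * (1 - c) ->
  sc_partially_hyperbolic (dmap A lu bu c).
Proof.
move=> fr detA c0 c1 dom; split;
  first exact: dmap_endomorphism fr detA c0 c1 dom.
have [E1 [E2 [/filter_ex[k [dk sck]] _]]] := hyperbolic_splitting fr c0 c1 dom.
by exists E1, E2, 1, k.
Qed.

Lemma toral_linear_anosov (R : realType) (A : 'M[int]_2) (ls lu bs bu : R) :
  eigenframe A ls lu bs bu -> 2 <= `|\det A| -> anosov (@toral_linear R A).
Proof.
move=> fr detA; rewrite -(dmap_flat A lu bu).
have lsu : `|ls| < `|lu| * (1 - 0).
  by rewrite subr0 mulr1 (lt_trans (ls_lt1 fr)) ?(lu_gt1 fr).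
split; first exact: dmap_endomorphism fr detA (lexx 0) ltr01 lsu.
have [E1 [E2 [nearsc nearcu]]] := hyperbolic_splitting fr (lexx 0) ltr01 lsu.
have /nearcu{}nearcu : 1 < `|lu| * (1 - 0) by rewrite subr0 mulr1 (lu_gt1 fr).
have [k [[dk sck] cuk]] := filter_ex (filterI nearsc nearcu).
by exists E1, E2, 1, k.
Qed.

Theorem proposition4 (R : realType) (A : 'M[int]_2) (hA : linear_anosov R A) :
  exists g0 : torus R -> torus R,
    [/\ tsmooth g0,
        sc_DA g0,
        (exists h : torus R -> torus R,
           semi_conjugacy h g0 (@toral_linear R A) /\ homotopic h id) &
        forall h : torus R -> torus R,
          semi_conjugacy h g0 (@toral_linear R A) -> homotopic h id ->
          ~ injective h].
Proof.
have [ls [lu [bs [bu fr]]]] := linear_anosov_eigenframe hA.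
have [detA _] := hA.
have lu1 := lu_gt1 fr; have ls1 := ls_lt1 fr; have ls0 := ls_gt0 fr.
have lu0 : 0 < `|lu| by exact: lt_trans lu1.
(* The derivative at 0 along eu is brought down to the midpoint of |ls| and 1:
   contracting, yet still dominating the stable eigenvalue. *)
pose r := (`|ls| + 1) / 2 / `|lu|; pose c := 1 - r.
have lur : `|lu| * (1 - c) = (`|ls| + 1) / 2.
  by rewrite /c subKr /r mulrC divfK// gt_eqF.
have r0 : 0 < r by rewrite !divr_gt0// addr_gt0.
have r1 : r < 1 by rewrite /r ltr_pdivrMr//; lra.
have c0 : 0 <= c by rewrite subr_ge0 ltW.
have c1 : c < 1 by rewrite /c ltrBlDr ltrDl.
have dom : `|ls| < `|lu| * (1 - c) by rewrite lur; lra.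
have sink : `|lu| * (1 - c) < 1 by rewrite lur; lra.
have sc := dmap_sc_partially_hyperbolic fr detA c0 c1 dom.
exists (dmap A lu bu c); split.
- by move=> k p; exact: tCk_dmap.
- split=> //; split.
    have [endo [E1 [E2 [alpha [k [dk sck]]]]]] := sc; split=> //.
    by exists E1, E2, alpha, k; split=> //; left.
  exists A; split; first exact: dmap_homotopic.
  exact: toral_linear_anosov fr detA.
- exact: dmap_semi_conjugacy fr c0.
- by move=> h hh _; exact: semi_conjugacy_not_injective fr c0 c1 sink h hh.
Qed.
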